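(* There exist a finitely presented automatic monoid $S$ and an automatic structure for $S$, with language of representatives $L$ and interpretation $\sigma$, such that there is no algorithm which, given a word $w\in L$, decides whether $\sigma(w)$ has a right inverse in $S$.
   Context: Let $A$ be a finite alphabet, $\$ \notin A$, and let $\delta$ send a pair of words over $A$ to the word over $(A\cup\{\$\})\times(A\cup\{\$\})$ obtained by padding the shorter word on the right with $\$$ and reading both letter by letter. A synchronous automaton recognises a relation $R$ if it accepts exactly $\delta(R)$. An automatic structure for a semigroup $S$ consists of a finite alphabet $A$, a finite automaton recognising $L\subseteq A^*$, a synchronous automaton recognising $L_=\subseteq L\times L$, and for each $a\in A$ a synchronous automaton recognising $L_a\subseteq L\times L$, together with the existence of a morphism $\sigma:A^*\to S$ (an interpretation) with $\sigma(L)=S$ such that for $u,v\in L$: $(u,v)\in L_=$ iff $\sigma(u)=\sigma(v)$, and $(u,v)\in L_a$ iff $\sigma(ua)=\sigma(v)$. A semigroup is automatic if it has an automatic structure. In a monoid with identity $1$, a right inverse of $s$ is an element $t$ with $st=1$. *)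

(* Defs.v *)
From mathcomp Require Import all_boot.
Set Implicit Arguments. Unset Strict Implicit. Unset Printing Implicit Defensive.

Record monoid := Monoid {
  mcarrier :> Type;
  mmul : mcarrier -> mcarrier -> mcarrier;
  mone : mcarrier;
  mmulA : forall x y z, mmul x (mmul y z) = mmul (mmul x y) z;
  mmul1l : forall x, mmul mone x = x;
  mmul1r : forall x, mmul x mone = x }.

Definition is_morphism (A : Type) (S : monoid) (sigma : seq A -> S) :=
  sigma [::] = mone S /\ forall u v, sigma (u ++ v) = mmul (sigma u) (sigma v).

Definition has_right_inverse (S : monoid) (s : S) := exists t : S, mmul s t = mone S.

Inductive cong_gen (X : Type) (rels : seq (seq X * seq X)) : seq X -> seq X -> Prop :=
| cg_refl u : cong_gen rels u u
| cg_sym u v : cong_gen rels u v -> cong_gen rels v u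
| cg_trans u v w : cong_gen rels u v -> cong_gen rels v w -> cong_gen rels u w
| cg_rule p q i : i < size rels -> let l := (nth ([::], [::]) rels i).1 in let r := (nth ([::], [::]) rels i).2 in
    cong_gen rels (p ++ l ++ q) (p ++ r ++ q).

Definition finitely_presented (S : monoid) :=
  exists (n : nat) (rels : seq (seq 'I_n * seq 'I_n)) (phi : seq 'I_n -> S),
    is_morphism phi /\ (forall s : S, exists u, phi u = s) /\
    (forall u v, phi u = phi v <-> cong_gen rels u v).

Record dfa (B : Type) := Dfa {
  dstate : finType;
  dstart : dstate;
  dfinal : pred dstate;
  dtrans : dstate -> B -> dstate }.

Definition accepts (B : Type) (M : dfa B) (w : seq B) : bool :=
  @dfinal B M (foldl (@dtrans B M) (@dstart B M) w).

(* delta(u,v): pad the shorter word with $ (= None) on the right *)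
Definition pad (A : Type) (u v : seq A) : seq (option A * option A) :=
  mkseq (fun i => (onth u i, onth v i)) (maxn (size u) (size v)).

Definition recognizes_rel (A : Type) (M : dfa (option A * option A))
    (R : seq A -> seq A -> Prop) :=
  forall x, accepts M x <-> exists u v, R u v /\ x = pad u v.

Definition automatic_structure (A : finType) (S : monoid) (sigma : seq A -> S)
    (ML : dfa A) (Meq : dfa (option A * option A))
    (Ma : A -> dfa (option A * option A)) :=
  is_morphism sigma /\
  (forall s : S, exists u, accepts ML u /\ sigma u = s) /\
  recognizes_rel Meq (fun u v => accepts ML u /\ accepts ML v /\ sigma u = sigma v) /\
  (forall a, recognizes_rel (Ma a)
     (fun u v => accepts ML u /\ accepts ML v /\ sigma (u ++ [:: a]) = sigma v)).

Inductive prf : Type :=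
| PZero
| PSucc
| PProj (i : nat)
| PComp (f : prf) (gs : list prf)
| PRec (f g : prf)
| PMu (f : prf).

Inductive eval : prf -> seq nat -> nat -> Prop :=
| ev_zero xs : eval PZero xs 0
| ev_succ x xs : eval PSucc (x :: xs) x.+1
| ev_proj i xs : i < size xs -> eval (PProj i) xs (nth 0 xs i)
| ev_comp f gs xs ys y : evals gs xs ys -> eval f ys y -> eval (PComp f gs) xs y
| ev_rec0 f g xs y : eval f xs y -> eval (PRec f g) (0 :: xs) y
| ev_recS f g n xs r y : eval (PRec f g) (n :: xs) r -> eval g (n :: r :: xs) y ->
    eval (PRec f g) (n.+1 :: xs) y
| ev_mu f xs n : eval f (n :: xs) 0 ->
    (forall m, m < n -> exists r, eval f (m :: xs) r.+1) -> eval (PMu f) xs n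
with evals : list prf -> seq nat -> seq nat -> Prop :=
| evs_nil xs : evals nil xs [::]
| evs_cons g gs xs y ys : eval g xs y -> evals gs xs ys -> evals (g :: gs) xs (y :: ys).

(* standard encoding of a word over 'I_k as a natural number
   (bijective base-k numeral, letter a is digit a+1, first letter least significant) *)
Definition word_code (k : nat) (w : seq 'I_k) : nat :=
  foldr (fun (a : 'I_k) n => a.+1 + k * n) 0 w.

Definition decidable_on (k : nat) (D : seq 'I_k -> Prop) (P : seq 'I_k -> Prop) :=
  exists f : prf, forall w, D w ->
    (P w /\ eval f [:: word_code w] 1) \/ (~ P w /\ eval f [:: word_code w] 0).

(* Main.v *)
From HB Require Import structures.
Require Import Defs.
From mathcomp Require Import all_boot.
From mathcomp Require Import zify.
Set Implicit Arguments. Unset Strict Implicit. Unset Printing Implicit Defensive.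

(* A queue machine with states [s] is turned into a monoid.  Letters [Lt a] are pushed at
   the right end of a block, pops [Pp a] commute with letters and so travel to the left
   end, and the marker [Sh] there absorbs a letter together with the matching pop.  The
   relation [Dl s * Tk t = op * Dl s'] lets the token [Tk t] perform one instruction, so
   the word [Sh u Dl s] is right invertible iff the machine, started in state [s] on the
   queue [u], halts with an empty queue.  The obvious rewriting system is
   complete, and multiplying a normal form by a generator inserts or deletes at most one
   letter (and may change the last one), which a synchronous automaton can check.

   Some such machine has an undecidable halting problem on inputs [1^n]: recursive
   functions compile to counter programs, these (coding the registers by a product of prime
   powers) to maps [n |-> A_r * (n / Q^2) + B_r], [r = n mod Q^2], and the table [A], [B] to
   a number [T].  Iterating such a map from [(Q, T)] is recursive, hence is itself done by
   one fixed map, which is the one the queue machine iterates.  A decision procedure,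
   composed with the coding of words, would be such a map; running it on its own number
   is contradictory. *)

(** * Primitive recursive arithmetic *)

Definition computable n (F : seq nat -> nat) :=
  exists p, forall xs, size xs = n -> eval p xs (F xs).

Lemma computable_ext n F G :
  computable n F -> (forall xs, size xs = n -> F xs = G xs) -> computable n G.
Proof. by case=> p Hp eqFG; exists p => xs Hxs; rewrite -eqFG //; apply: Hp. Qed.

Lemma computable_proj n i : i < n -> computable n (fun xs => nth 0 xs i).
Proof. by move=> Hi; exists (PProj i) => xs Hxs; apply: ev_proj; rewrite Hxs. Qed.

Lemma computable_comp1 n F G :
  computable 1 F -> computable n G -> computable n (fun xs => F [:: G xs]).
Proof.
case=> f Hf [g Hg]; exists (PComp f [:: g]) => xs Hxs.
by apply: (ev_comp (ys := [:: G xs])); [repeat constructor; auto | apply: Hf].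
Qed.

Lemma computable_comp2 n F G1 G2 :
  computable 2 F -> computable n G1 -> computable n G2 ->
  computable n (fun xs => F [:: G1 xs; G2 xs]).
Proof.
case=> f Hf [g1 H1] [g2 H2]; exists (PComp f [:: g1; g2]) => xs Hxs.
by apply: (ev_comp (ys := [:: G1 xs; G2 xs])); [repeat constructor; auto | apply: Hf].
Qed.

Lemma computable_succ n F : computable n F -> computable n (fun xs => (F xs).+1).
Proof.
case=> f Hf; exists (PComp PSucc [:: f]) => xs Hxs.
by apply: (ev_comp (ys := [:: F xs])); [repeat constructor; auto | constructor].
Qed.

Lemma computable_const n c : computable n (fun=> c).
Proof.
elim: c => [|c IH]; last exact: (computable_succ IH).
by exists PZero => xs _; constructor.
Qed.

Lemma computable_rec n F G : computable n F -> computable n.+2 G ->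
  computable n.+1 (fun xs => nat_rect (fun=> nat) (F (behead xs))
                     (fun k r => G [:: k, r & behead xs]) (head 0 xs)).
Proof.
case=> f Hf [g Hg]; exists (PRec f g) => -[//|k xs] /= [Hxs].
elim: k => [|k IH] /=; first by constructor; apply: Hf.
by apply: ev_recS IH _; apply: Hg; rewrite /= Hxs.
Qed.

Ltac comp_ext := move=> [|x0 [|x1 [|x2 [|x3 xs]]]] //= _.

Lemma computable_add n F G : computable n F -> computable n G ->
  computable n (fun xs => F xs + G xs).
Proof.
apply: (@computable_comp2 n (fun xs => nth 0 xs 0 + nth 0 xs 1)).
have := computable_rec (computable_proj (n := 1) (i := 0) isT)
  (computable_succ (computable_proj (n := 3) (i := 1) isT)).
by move/computable_ext; apply; comp_ext; elim: x0 => //= x0 ->; rewrite addSn.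
Qed.

Lemma computable_mul n F G : computable n F -> computable n G ->
  computable n (fun xs => F xs * G xs).
Proof.
apply: (@computable_comp2 n (fun xs => nth 0 xs 0 * nth 0 xs 1)).
have := computable_rec (computable_const 1 0)
  (computable_add (computable_proj (n := 3) (i := 1) isT)
                  (computable_proj (n := 3) (i := 2) isT)).
by move/computable_ext; apply; comp_ext; elim: x0 => //= x0 ->; rewrite mulSn addnC.
Qed.

Lemma computable_exp n F G : computable n F -> computable n G ->
  computable n (fun xs => F xs ^ G xs).
Proof.
move=> HF HG.
(* Primitive recursion runs on the first argument, so the exponent is put first. *)
apply: (@computable_comp2 n (fun xs => nth 0 xs 1 ^ nth 0 xs 0) _ _ _ HG HF).
have := computable_rec (computable_const 1 1)
  (computable_mul (computable_proj (n := 3) (i := 1) isT)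
                  (computable_proj (n := 3) (i := 2) isT)).
by move/computable_ext; apply; comp_ext; elim: x0 => //= x0 ->; rewrite expnSr.
Qed.

Lemma computable_sub n F G : computable n F -> computable n G ->
  computable n (fun xs => F xs - G xs).
Proof.
move=> HF HG.
apply: (@computable_comp2 n (fun xs => nth 0 xs 1 - nth 0 xs 0) _ _ _ HG HF).
have Hpred : computable 3 (fun xs => (nth 0 xs 1).-1).
  apply: (@computable_comp1 3 (fun xs => (nth 0 xs 0).-1)); last exact: computable_proj.
  have := computable_rec (computable_const 0 0) (computable_proj (n := 2) (i := 0) isT).
  by move/computable_ext; apply; comp_ext; case: x0.
have := computable_rec (computable_proj (n := 1) (i := 0) isT) Hpred.
move/computable_ext; apply; comp_ext; elim: x0 => [|x0 /= ->]; by rewrite ?subn0 ?subnS.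
Qed.

(** With truncated subtraction, [(F - G) + (G - F)] is the distance, and subtracting it from 1 gives
    the test. *)
Lemma computable_eq n F G : computable n F -> computable n G ->
  computable n (fun xs => F xs == G xs : nat).
Proof.
move=> HF HG; have H1 := computable_const n 1.
have := computable_sub H1 (computable_add (computable_sub HF HG) (computable_sub HG HF)).
move/computable_ext; apply=> xs _.
by case: eqP; lia.
Qed.

(** From [n] to [n + 1] the remainder grows by one and is reset to 0 when it hits the divisor. For
    divisor 0 the reset never happens, in line with [n %% 0 = n]. *)
Lemma computable_mod n F G : computable n F -> computable n G ->
  computable n (fun xs => F xs %% G xs).
Proof.
apply: (@computable_comp2 n (fun xs => nth 0 xs 0 %% nth 0 xs 1)).
have Hr := computable_succ (computable_proj (n := 3) (i := 1) isT).
have := computable_rec (computable_const 1 0) (computable_mul Hr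
   (computable_sub (computable_const 3 1)
      (computable_eq Hr (computable_proj (n := 3) (i := 2) isT)))).
move/computable_ext; apply; comp_ext; elim: x0 => [|n0 /= ->]; first by rewrite mod0n.
rewrite modnS; case: x1 => [|d]; first by rewrite !modn0 dvd0n /= subn0 muln1.
rewrite dvdn_eq; have := divn_eq n0 d.+1; have := ltn_pmod n0 (ltn0Sn d).
move: (n0 %% _) (n0 %/ _) => r q Hr0 Eq; case: eqP => [[Er]|Er] /=.
  rewrite subnn muln0 ifT // Eq Er -addnS -mulSnr mulnK //.
rewrite muln1 ifF //; apply/eqP => H; suff: r.+1 %% d.+1 = 0 by rewrite modn_small //; lia.
have : n0.+1 %% d.+1 = 0 by rewrite -H modnMl.
by rewrite Eq -addnS modnMDl.
Qed.

(** The quotient grows by one exactly when a positive divisor divides [n + 1]. *)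
Lemma computable_div n F G : computable n F -> computable n G ->
  computable n (fun xs => F xs %/ G xs).
Proof.
apply: (@computable_comp2 n (fun xs => nth 0 xs 0 %/ nth 0 xs 1)).
have Hm : computable 3 (fun xs => (nth 0 xs 0).+1 %% nth 0 xs 2 == 0 : nat).
  apply: computable_eq; last exact: computable_const.
  by apply: computable_mod; [apply: computable_succ|]; apply: computable_proj.
have := computable_rec (computable_const 1 0)
  (computable_add (computable_mul (computable_sub (computable_const 3 1)
      (computable_eq (computable_proj (n := 3) (i := 2) isT) (computable_const 3 0))) Hm)
     (computable_proj (n := 3) (i := 1) isT)).
move/computable_ext; apply; comp_ext; elim: x0 => [|n0 /= ->]; first by rewrite div0n.
case: x1 => [|d] /=; first by rewrite !divn0.
by rewrite mul1n divnS // /dvdn.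
Qed.

(** * From recursive functions to counter programs *)

Inductive cmd : Type :=
| CInc (i : nat)
| CDec (i : nat)
| CSeq (c1 c2 : cmd)
| CLoop (i : nat) (c : cmd).

Definition upd (s : nat -> nat) i x := fun j => if j == i then x else s j.

(* [CLoop i c] decrements register [i] before each execution of [c]. *)
Inductive run : cmd -> (nat -> nat) -> (nat -> nat) -> Prop :=
| run_inc i s : run (CInc i) s (upd s i (s i).+1)
| run_dec i s : run (CDec i) s (upd s i (s i).-1)
| run_seq c1 c2 s1 s2 s3 : run c1 s1 s2 -> run c2 s2 s3 -> run (CSeq c1 c2) s1 s3
| run_loop0 i c s : s i = 0 -> run (CLoop i c) s s
| run_loopS i c s1 s2 s3 : 0 < s1 i -> run c (upd s1 i (s1 i).-1) s2 ->
    run (CLoop i c) s2 s3 -> run (CLoop i c) s1 s3.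

Lemma upd_eq s i x : upd s i x i = x. Proof. by rewrite /upd eqxx. Qed.
Lemma upd_neq s i x j : j != i -> upd s i x j = s j.
Proof. by rewrite /upd => /negbTE->. Qed.

(** Loop rule with an invariant indexed by the loop register: the body must give that register back
    unchanged, so the number of rounds is known in advance. *)
Lemma run_loop_iter i c (I : nat -> (nat -> nat) -> Prop) n s :
  s i = n -> I n s ->
  (forall k s1, s1 i = k.+1 -> I k.+1 s1 ->
     exists s2, [/\ run c (upd s1 i k) s2, s2 i = k & I k s2]) ->
  exists s', [/\ run (CLoop i c) s s', s' i = 0 & I 0 s'].
Proof.
move=> Hs HI Hstep; elim: n s Hs HI => [|n IH] s Hs HI.
  by exists s; split=> //; apply: run_loop0.
have [s2 [R E HI2]] := Hstep _ _ Hs HI.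
have [s3 [R3 E3 HI3]] := IH _ E HI2.
by exists s3; split=> //; apply: (run_loopS (s2 := s2)); rewrite ?Hs.
Qed.

Definition clear i := CLoop i (CDec i).

(** The body decrements [i] again after the loop has done so, hence a round may remove two units and
    strong induction is used. *)
Lemma run_clear i s :
  exists s', [/\ run (clear i) s s', s' i = 0 & forall r, r != i -> s' r = s r].
Proof.
move En: (s i) => n; elim/ltn_ind: n s En => -[|n] IH s En.
  by exists s; split=> //; apply: run_loop0.
have [|s' [R E H]] := IH n.-1 _ (upd (upd s i n) i n.-1) (upd_eq _ _ _); first by lia.
exists s'; split=> // [|r Hr]; last by rewrite H // !upd_neq.
apply: (run_loopS (s2 := upd (upd s i n) i n.-1)); rewrite ?En //.
by have := run_dec i (upd s i n); rewrite upd_eq.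
Qed.

(** Reading a register by a loop destroys it: [i] is moved into [o] and [t] at once and then
    restored from [t]. *)
Definition copy i o t := CSeq (clear o) (CSeq (clear t)
  (CSeq (CLoop i (CSeq (CInc o) (CInc t))) (CLoop t (CInc i)))).

Lemma run_copy i o t s : i != o -> i != t -> o != t ->
  exists s', [/\ run (copy i o t) s s', s' o = s i & forall r, r != o -> r != t -> s' r = s r].
Proof.
move=> io it ot; have oi : o != i by rewrite eq_sym.
have ti : t != i by rewrite eq_sym.
have to : t != o by rewrite eq_sym.
have [s1 [R1 E1 H1]] := run_clear o s.
have [s2 [R2 E2 H2]] := run_clear t s1.
have Ei : s2 i = s i by rewrite H2 // H1.
pose I n (s3 : nat -> nat) := [/\ s3 o + n = s i, s3 t + n = s i &
     forall r, r != i -> r != o -> r != t -> s3 r = s r].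
have I2 : I (s i) s2.
  by split=> [||r ri ro rt]; rewrite ?E2 // H2 ?E1 ?H1.
have [k s3 E3 [Io It Ir]|s3 [R3 E3 [Eo Et H3]]] :=
    run_loop_iter (c := CSeq (CInc o) (CInc t)) Ei I2.
  exists (upd (upd (upd s3 i k) o (s3 o).+1) t (s3 t).+1); split.
  - apply: (run_seq (s2 := upd (upd s3 i k) o (s3 o).+1)).
      by have := run_inc o (upd s3 i k); rewrite upd_neq.
    by have := run_inc t (upd (upd s3 i k) o (s3 o).+1); rewrite !(@upd_neq _ _ _ t).
  - by rewrite /upd (negbTE it) (negbTE io) eqxx.
  - split=> [||r ri ro rt]; rewrite /upd ?eqxx ?(negbTE ot); try lia.
    by rewrite (negbTE rt) (negbTE ro) (negbTE ri) Ir.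
pose J n (s4 : nat -> nat) := [/\ s4 o = s i, s4 i + n = s i &
     forall r, r != i -> r != o -> r != t -> s4 r = s r].
have J3 : J (s i) s3 by split=> //; rewrite -?Eo ?E3 ?addn0 //.
have Et' : s3 t = s i by rewrite -Et addn0.
have [k s4 E4 [Io Ii Ir]|s4 [R4 E4 [Eo4 Et4 H4]]] := run_loop_iter (c := CInc i) Et' J3.
  exists (upd (upd s4 t k) i (s4 i).+1); split.
  - by have := run_inc i (upd s4 t k); rewrite (@upd_neq _ _ _ i).
  - by rewrite /upd (negbTE ti) eqxx.
  - split=> [||r ri ro rt]; rewrite /upd ?eqxx ?(negbTE oi) ?(negbTE ot) //; try lia.
    by rewrite (negbTE rt) (negbTE ri) Ir.
exists s4; split=> // [|r ro rt].
  by apply: run_seq R1 _; apply: run_seq R2 _; apply: run_seq R3 R4.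
by have [->|ri] := eqVneq r i; [lia | apply: H4].
Qed.

(** Inputs sit in the registers [ins], the result goes to [o], and all registers from [b] on are
    scratch. For [PComp], the values of [gs] are parked in registers [b] to [k - 1]; for [PMu], [b]
    holds the candidate and [b.+1] the value of [f] there. *)
Fixpoint compile (f : prf) (ins : seq nat) (o b : nat) : cmd :=
  match f with
  | PZero => clear o
  | PSucc => CSeq (copy (nth 0 ins 0) o b) (CInc o)
  | PProj i => copy (nth 0 ins i) o b
  | PComp f gs =>
      let k := b + size gs in
      let last := compile f (iota b (size gs)) o k in
      (fix comps gs j := match gs with
        | [::] => last
        | g :: gs => CSeq (compile g ins j k) (comps gs j.+1)
        end) gs b
  | PRec f g => (* counter b, accumulator b+1, index b+2 *)
      CSeq (copy (nth 0 ins 0) b b.+4) (CSeq (compile f (behead ins) b.+1 b.+4)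
      (CSeq (clear b.+2) (CSeq
        (CLoop b (CSeq (compile g [:: b.+2, b.+1 & behead ins] b.+3 b.+4)
                 (CSeq (copy b.+3 b.+1 b.+4) (CInc b.+2))))
        (copy b.+1 o b.+4))))
  | PMu f =>
      CSeq (clear b) (CSeq (compile f (b :: ins) b.+1 b.+2)
      (CSeq (CLoop b.+1 (CSeq (CInc b) (compile f (b :: ins) b.+1 b.+2)))
        (copy b o b.+2)))
  end.

(** The generated induction principle gives no hypothesis for the list nested in [PComp]; here a
    [foldr] of conjunctions carries it to each entry. *)
Lemma prf_list_ind (P : prf -> Prop) :
  P PZero -> P PSucc -> (forall i, P (PProj i)) ->
  (forall f gs, P f -> foldr (fun g Q => P g /\ Q) True gs -> P (PComp f gs)) ->
  (forall f g, P f -> P g -> P (PRec f g)) -> (forall f, P f -> P (PMu f)) ->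
  forall f, P f.
Proof.
move=> HZ HS HP HC HR HM; fix IH 1 => -[||i|f gs|f g|f].
- exact: HZ.
- exact: HS.
- exact: HP.
- apply: HC; first exact: IH.
  by elim: gs => [|g gs IHgs] /=; [|split; [apply: IH | apply: IHgs]].
- by apply: HR; exact: IH.
- by apply: HM; exact: IH.
Qed.

Lemma eval_zero_inv xs y : eval PZero xs y -> y = 0.
Proof. by inversion 1. Qed.

Lemma eval_succ_inv xs y : eval PSucc xs y -> exists x xs', xs = x :: xs' /\ y = x.+1.
Proof. by inversion 1; exists x, xs0. Qed.

Lemma eval_proj_inv i xs y : eval (PProj i) xs y -> i < size xs /\ y = nth 0 xs i.
Proof. by inversion 1. Qed.

Lemma eval_comp_inv f gs xs y : eval (PComp f gs) xs y ->
  exists ys, evals gs xs ys /\ eval f ys y.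
Proof. by inversion 1; exists ys. Qed.

Lemma evals_inv g gs xs zs : evals (g :: gs) xs zs ->
  exists y ys, [/\ zs = y :: ys, eval g xs y & evals gs xs ys].
Proof. by inversion 1; exists y, ys. Qed.

(** All intermediate values are collected in one sequence [rs], from which the invariant of the
    compiled loop is read off. *)
Lemma eval_rec_inv f g xs y : eval (PRec f g) xs y -> exists n xs', xs = n :: xs' /\
  exists rs : nat -> nat, [/\ rs n = y, eval f xs' (rs 0) &
    forall k, k < n -> eval g [:: k, rs k & xs'] (rs k.+1)].
Proof.
case: xs => [|n xs]; first by inversion 1.
move=> H; exists n, xs; split=> //; elim: n y H => [|n IH] y H.
  by inversion H; exists (fun=> y).
have [r [Hr Hy]] : exists r, eval (PRec f g) (n :: xs) r /\ eval g [:: n, r & xs] y.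
  by inversion H; exists r.
have [rs [Ers H0 HS]] := IH _ Hr.
exists (fun k => if k == n.+1 then y else rs k); split; rewrite ?eqxx //.
move=> k Hk; rewrite eqSS ltn_eqF //.
by have [->|kn] := eqVneq k n; [rewrite Ers | apply: HS; lia].
Qed.

Lemma eval_mu_inv f xs n : eval (PMu f) xs n ->
  eval f (n :: xs) 0 /\ forall m, m < n -> exists r, eval f (m :: xs) r.+1.
Proof. by inversion 1. Qed.

(** Registers below [b] other than [o] survive, so the inputs and the data of the caller stay
    readable. The output is not an input because [o] may be cleared before the inputs are read. *)
Definition compile_spec f := forall ins xs o b s y, eval f xs y -> map s ins = xs ->
  all (fun i => i < b) ins -> o < b -> o \notin ins ->
  exists s', [/\ run (compile f ins o b) s s', s' o = y &
    forall r, r < b -> r != o -> s' r = s r].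

Lemma map_agree (s s' : nat -> nat) b (ins : seq nat) : all (fun i => i < b) ins ->
  (forall r, r < b -> s' r = s r) -> map s' ins = map s ins.
Proof. by move=> /allP Hb H; apply/eq_in_map => i /Hb /H. Qed.

Lemma all_lt_weaken b b' (ins : seq nat) : b <= b' ->
  all (fun i => i < b) ins -> all (fun i => i < b') ins.
Proof. by move=> Hbb; apply: sub_all => i Hi; apply: leq_trans Hi Hbb. Qed.

Lemma notin_all_lt b i (ins : seq nat) : b <= i -> all (fun i => i < b) ins -> i \notin ins.
Proof. by move=> bi /allP H; apply/negP => /H; rewrite ltnNge bi. Qed.

Lemma compile_correct f : compile_spec f.
Proof.
elim/prf_list_ind: f => [||i|f gs IHf IHgs|f g IHf IHg|f IHf] ins xs o b s y Hev Hs Hb Ho Hoi.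
- rewrite (eval_zero_inv Hev).
  by have [s' [R E H]] := run_clear o s; exists s'; split=> // r _ /H.
- have [x [xs' [Exs ->]]] := eval_succ_inv Hev; rewrite {}Exs in Hs.
  case: ins Hb Hoi Hs => [//|i ins] /= /andP[ib Hb]; rewrite inE negb_or => /andP[oi Hoi] [<- _].
  have [||| s' [R E H]] := @run_copy i o b s; rewrite 1?eq_sym //; try lia.
  exists (upd s' o (s' o).+1); split; first by apply: run_seq R (run_inc _ _).
    by rewrite upd_eq E.
  by move=> r rb ro; rewrite upd_neq // H // neq_ltn rb.
- have [] := eval_proj_inv Hev; rewrite -Hs size_map => Hi ->; rewrite (nth_map 0) //=.
  have Hin := mem_nth 0 Hi; have ib := allP Hb _ Hin.
  have io : nth 0 ins i != o by apply: contraNneq Hoi => <-.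
  have [||| s' [R E H]] := @run_copy (nth 0 ins i) o b s; rewrite ?io ?neq_ltn ?ib ?Ho //.
  by exists s'; split=> // r rb ro; apply: H => //; rewrite neq_ltn rb.
- have [ys [Hgs Hf]] := eval_comp_inv Hev.
  rewrite /=; move Ek: (b + size gs) => k; set c := compile f _ o k.
  have Hlast s1 : map s1 (iota b (size gs)) = ys -> exists s', [/\ run c s1 s', s' o = y &
      forall r, r < b -> r != o -> s' r = s1 r].
    move=> Hys; have [|||s' [R E H]] := IHf _ _ o k s1 _ Hf Hys.
    + by apply/allP => i; rewrite mem_iota => /andP[_]; lia.
    + by lia.
    + by rewrite mem_iota; lia.
    by exists s'; split=> // r rb; apply: H; lia.
  (* Induction over the arguments still to be computed: [ws] are the values already stored in
     registers [b] to [j - 1], and [zs] those still due. *)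
  suff: forall hs zs ws j s1, foldr (fun g Q => compile_spec g /\ Q) True hs -> evals hs xs zs ->
      (forall s2, map s2 (iota b (size gs)) = ws ++ zs -> exists s',
       [/\ run c s2 s', s' o = y & forall r, r < b -> r != o -> s' r = s2 r]) ->
      j + size hs = k -> b <= j -> (forall r, r < b -> s1 r = s r) ->
      map s1 (iota b (j - b)) = ws ->
      exists s', [/\ run ((fix comps hs j := match hs with
        | [::] => c
        | g :: gs => CSeq (compile g ins j k) (comps gs j.+1)
        end) hs j) s1 s', s' o = y & forall r, r < b -> r != o -> s' r = s r].
    by move/(_ gs ys [::] b s); apply=> //; rewrite subnn.
  elim=> [|g hs IHhs] zs ws j s1 /=.
    move=> _ Hz Hc Ej bj Hagree Hws; inversion Hz; subst zs.
    have [|s' [R E H]] := Hc s1; first by rewrite cats0 -Hws; congr (map _ (iota _ _)); lia.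
    by exists s'; split=> // r rb ro; rewrite H // Hagree.
  move=> [Hg Hhs] /evals_inv[z [zs' [-> Hz Hzs]]] Hc Ej bj Hagree Hws.
  have [||||s2 [R2 E2 H2]] := Hg ins xs j k s1 z Hz.
  + by rewrite -Hs; apply: map_agree Hb Hagree.
  + by apply: all_lt_weaken Hb; lia.
  + by lia.
  + by apply: notin_all_lt Hb.
  have [|||||s3 [R3 E3 H3]] := IHhs zs' (rcons ws z) j.+1 s2 Hhs Hzs.
  + by move=> s3; rewrite cat_rcons; apply: Hc.
  + by lia.
  + by lia.
  + by move=> r rb; rewrite H2; [apply: Hagree | lia | lia].
  + rewrite subSn // -addn1 iotaD map_cat /= subnKC // E2 -cats1 -Hws; congr cat.
    apply/eq_in_map => r; rewrite mem_iota => /andP[br rj]; rewrite H2 //; lia.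
  by exists s3; split=> //; apply: run_seq R2 R3.
- have [n [xs' [Exs [rs [Ey H0 HS]]]]] := eval_rec_inv Hev; rewrite {}Exs in Hs.
  case: ins Hb Hoi Hs => [//|i ins] /= /andP[ib Hb]; rewrite inE negb_or => /andP[oi Hoi] [Ei Hs].
  have Hb4 : all (fun i => i < b.+4) ins by apply: all_lt_weaken Hb; lia.
  have [||| s1 [R1 E1 H1]] := @run_copy i b b.+4 s; try lia.
  have [||||s2 [R2 E2 H2]] := IHf ins xs' b.+1 b.+4 s1 _ H0; try by []; try lia.
    by rewrite -Hs; apply: map_agree Hb _ => r rb; apply: H1; lia.
    by apply: notin_all_lt Hb; lia.
  have [s3 [R3 E3 H3]] := run_clear b.+2 s2.
  (* With [k] rounds left, the index is [n - k] and the accumulator is the value of the recursion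
     there. *)
  pose I k (t : nat -> nat) := [/\ k <= n, t b.+2 = n - k, t b.+1 = rs (n - k) &
    forall r, r < b -> t r = s r].
  have I3 : I n s3.
    split=> [||| r rb]; rewrite ?subnn //; first by rewrite H3 //; lia.
    rewrite H3 ?H2 ?H1 //; lia.
  have E3b : s3 b = n by rewrite H3 ?H2 ?E1 //; lia.
  have [k t Et [Ik I2 I1 Ir]|s4 [R4 E4 [_ _ I1 Ir]]] := run_loop_iter (c :=
    CSeq (compile g [:: b.+2, b.+1 & ins] b.+3 b.+4) (CSeq (copy b.+3 b.+1 b.+4) (CInc b.+2)))
    E3b I3.
    set u := upd t b k.
    have Hu r : r != b -> u r = t r by move=> rb; rewrite /u upd_neq.
    have [|||||u1 [R5 E5 H5]] := IHg [:: b.+2, b.+1 & ins] [:: n - k.+1, rs (n - k.+1) & xs']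
       b.+3 b.+4 u (rs (n - k.+1).+1).
    + by apply: HS; lia.
    + rewrite /= !Hu; try lia; rewrite I1 I2 -Hs; congr [:: _, _ & _].
      by apply: map_agree Hb _ => r rb; rewrite Hu; [apply: Ir | lia].
    + by rewrite /= Hb4 andbT; lia.
    + by lia.
    + by rewrite !inE !negb_or (notin_all_lt _ Hb); lia.
    have [||| u2 [R6 E6 H6]] := @run_copy b.+3 b.+1 b.+4 u1; try lia.
    exists (upd u2 b.+2 (u2 b.+2).+1); split.
    + by apply: run_seq R5 _; apply: run_seq R6 (run_inc _ _).
    + rewrite upd_neq ?H6 ?H5 ?/u ?upd_eq //; lia.
    + split=> [|||r rb]; first by lia.
      * rewrite upd_eq H6 ?H5 ?Hu ?I2; lia.
      * rewrite upd_neq ?E6 ?E5 -?subSn //; lia.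
      * by rewrite upd_neq ?H6 ?H5 ?Hu ?Ir //; lia.
  have [||| s5 [R5 E5 H5]] := @run_copy b.+1 o b.+4 s4; try lia.
  exists s5; split; last by move=> r rb ro; rewrite H5 ?Ir //; lia.
    by apply: run_seq R1 _; apply: run_seq R2 _; apply: run_seq R3 _; apply: run_seq R4 R5.
  by rewrite E5 I1 subn0.
- have [Hn Hm] := eval_mu_inv Hev; rename y into n.
  have Hb2 : all (fun i => i < b.+2) ins by apply: all_lt_weaken Hb; lia.
  have Hstep (t : nat -> nat) z : eval f (t b :: xs) z -> (forall r, r < b -> t r = s r) ->
    exists t', [/\ run (compile f (b :: ins) b.+1 b.+2) t t', t' b.+1 = z, t' b = t b &
      forall r, r < b -> t' r = s r].
    move=> Hz Ht; have [||||t' [R E H]] := IHf (b :: ins) _ b.+1 b.+2 t _ Hz.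
    + by rewrite /= -Hs; congr cons; apply: map_agree Hb Ht.
    + by rewrite /= Hb2 andbT; lia.
    + by lia.
    + by rewrite inE negb_or (notin_all_lt _ Hb); lia.
    exists t'; split=> // [|r rb]; first by rewrite H //; lia.
    by rewrite H ?Ht //; lia.
  have [s1 [R1 E1 H1]] := run_clear b s.
  have Hev1 k : k <= n -> exists z, eval f (k :: xs) z /\ (z == 0) = (k == n).
    rewrite leq_eqVlt => /orP[/eqP->|kn]; first by exists 0; rewrite !eqxx.
    by have [z Hz] := Hm _ kn; exists z.+1; split=> //; rewrite (ltn_eqF kn).
  have [z0 [Hz0 Ez0]] := Hev1 0 (leq0n _).
  have [||s2 [R2 E2 E2b H2]] := Hstep s1 z0; rewrite ?E1 //.
    by move=> r rb; apply: H1; lia.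
  have [s3 [R3 E3 H3]] : exists s3, [/\ run (CLoop b.+1 (CSeq (CInc b)
      (compile f (b :: ins) b.+1 b.+2))) s2 s3,
      s3 b = n & forall r, r < b -> s3 r = s r].
    rewrite E1 in E2b; move Ed: (n - 0) => d.
    (* Invariant of the search: register [b] holds the candidate [k], and [b.+1] is zero exactly
       when [k = n]. The induction is on the distance [d] to [n]. *)
    have: exists k, [/\ k <= n, s2 b = k, n - k = d & (s2 b.+1 == 0) = (k == n)].
      by exists 0; rewrite E2b Ed E2 Ez0; split.
    move: H2; clear -Hev1 Hstep.
    elim: d s2 => [|d IH] t Ht [k [kn Etb Ed Et0]].
      exists t; split=> //; last by lia.
      by apply: run_loop0; apply/eqP; rewrite Et0; lia.
    have [z [Hz Ez]] := Hev1 k.+1 ltac:(lia).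
    set u := upd (upd t b.+1 (t b.+1).-1) b k.+1.
    have Eu : u b = k.+1 by rewrite /u upd_eq.
    have := Hstep u z; rewrite Eu => /(_ Hz)[|u1 [R E Eb H]].
      by move=> r rb; rewrite /u !upd_neq ?Ht //; lia.
    have [|u2 [R2 E2 H2]] := IH u1 H.
      by exists k.+1; rewrite Eb E Ez; split=> //; lia.
    exists u2; split=> //; apply: run_loopS R2; first by rewrite lt0n Et0; lia.
    apply: run_seq R.
    by have := run_inc b (upd t b.+1 (t b.+1).-1); rewrite upd_neq ?Etb //; lia.
  have [||| s4 [R4 E4 H4]] := @run_copy b o b.+2 s3; try lia.
  exists s4; split; first by apply: run_seq R1 _; apply: run_seq R2 _; apply: run_seq R3 R4.
    by rewrite E4.
  by move=> r rb ro; rewrite H4 ?H3 //; lia.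
Qed.

(** * From counter programs to iterated arithmetic maps *)

Inductive instr : Type :=
| IInc (i next : nat)
| IDec (i ifpos ifzero : nat).

Fixpoint clen c :=
  match c with
  | CInc _ | CDec _ => 1
  | CSeq c1 c2 => clen c1 + clen c2
  | CLoop _ c => (clen c).+1
  end.

(** [off] is the address of the first instruction and [exit] the one where control goes at the end;
    a loop body exits to its own test. *)
Fixpoint code c off exit : seq instr :=
  match c with
  | CInc i => [:: IInc i exit]
  | CDec i => [:: IDec i exit exit]
  | CSeq c1 c2 => code c1 off (off + clen c1) ++ code c2 (off + clen c1) exit
  | CLoop i c => IDec i off.+1 exit :: code c off.+1 off
  end.

Lemma size_code c off exit : size (code c off exit) = clen c.
Proof. by elim: c off exit => //= [c1 H1 c2 H2|i c H] off exit; rewrite ?size_cat ?H1 ?H2 ?H. Qed.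

Definition instr_wf K Q ins :=
  match ins with
  | IInc i t => (i < K) && (t < Q)
  | IDec i t1 t2 => [&& i < K, t1 < Q & t2 < Q]
  end.

Fixpoint regbound c :=
  match c with
  | CInc i | CDec i => i.+1
  | CSeq c1 c2 => maxn (regbound c1) (regbound c2)
  | CLoop i c => maxn i.+1 (regbound c)
  end.

Lemma clen_gt0 c : 0 < clen c.
Proof. by elim: c => //= c1 H1 c2 H2; rewrite addn_gt0 H1. Qed.

Lemma code_wf K Q c off exit : regbound c <= K -> off + clen c <= Q -> exit < Q ->
  all (instr_wf K Q) (code c off exit).
Proof.
elim: c off exit => [i|i|c1 H1 c2 H2|i c H] off exit /=.
- by move=> -> _ ->.
- by move=> -> _ ->.
- rewrite geq_max all_cat => /andP[K1 K2] Hoff Hex; have := clen_gt0 c2.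
  by move=> ?; rewrite H1 ?H2 //; lia.
- rewrite geq_max => /andP[-> Kc] Hoff ->; have := clen_gt0 c.
  by move=> ?; rewrite H //; lia.
Qed.

(** An increasing sequence of primes, not claimed to contain them all; primality and injectivity are
    what the coding uses. *)
Fixpoint pr i := if i is i.+1 then s2val (prime_above (pr i)) else 2.

Lemma pr_prime i : prime (pr i).
Proof. by case: i => [|i] //=; case: prime_above. Qed.

Lemma pr_inj : injective pr.
Proof.
have lt_pr i : pr i < pr i.+1 by rewrite /=; case: prime_above.
have mono : {homo pr : i j / i < j} by apply: homo_ltn lt_pr; apply: ltn_trans.
by move=> i j E; case: (ltngtP i j) => // /mono; rewrite E ltnn.
Qed.

Definition digit B T i := (T %/ B ^ i) %% B.

(** The table is packed from the top entry down, each entry becoming the new least significant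
    digit. *)
Lemma digits B N (d : nat -> nat) : (forall i, i < N -> d i < B) ->
  exists T, forall i, i < N -> digit B T i = d i.
Proof.
elim: N d => [|N IH] d Hd; first by exists 0.
have [T HT] := IH (fun i => d i.+1) (fun i Hi => Hd i.+1 Hi).
have H0 := Hd 0 isT; have B0 : 0 < B by apply: leq_ltn_trans H0.
exists (T * B + d 0) => -[|i] Hi; rewrite /digit.
  by rewrite expn0 divn1 modnMDl modn_small.
by rewrite expnS divnMA divnMDl // (divn_small H0) addn0 -(HT i).
Qed.

(* The residue of [n] mod [Q] is a program counter and [n %/ Q] the product of prime powers
   coding the registers; [T] lists, in base [Q ^ 4], the two coefficients used for each
   residue mod [Q ^ 2]. *)
Definition cstep Q T n :=
  digit (Q ^ 4) T (2 * (n %% Q ^ 2)) * (n %/ Q ^ 2) + digit (Q ^ 4) T (2 * (n %% Q ^ 2) + 1).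

(** Program counter 2, the first that does not halt, with [x] and [y] in registers 0 and 1 and zeros
    elsewhere. *)
Definition cinit Q x y := 2 + Q * (pr 0 ^ x * pr 1 ^ y).

(* Program counters 0 and 1 stand for acceptance and rejection. *)
Inductive reach Q T : nat -> nat -> Prop :=
| reach_refl n : reach Q T n n
| reach_step n n' : 1 < n %% Q -> reach Q T (cstep Q T n) n' -> reach Q T n n'.

Lemma reach_trans Q T n1 n2 n3 : reach Q T n1 n2 -> reach Q T n2 n3 -> reach Q T n1 n3.
Proof. by elim=> // n n' Hn _ IH /IH; apply: reach_step. Qed.

(** Write [n = pc + Q * g] and [g = Q * k + w], so that [k = n %/ Q ^ 2]. Incrementing multiplies
    [g] by a prime [p]: [t + Q * p * g = Q ^ 2 * p * k + (t + Q * p * w)]. For a decrement, [p]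
    divides [Q], so [p] divides [g] iff it divides [w], and then
    [g %/ p = (Q %/ p) * k + w %/ p]. *)
Definition coefA Q ins w :=
  match ins with
  | IInc i _ => Q ^ 2 * pr i
  | IDec i _ _ => if pr i %| w then Q * (Q %/ pr i) else Q ^ 2
  end.

Definition coefB Q ins w :=
  match ins with
  | IInc i t => t + Q * pr i * w
  | IDec i t1 t2 => if pr i %| w then t1 + Q * (w %/ pr i) else t2 + Q * w
  end.

(** * Simulating a counter program by one arithmetic map *)

Section Encoding.
Variables (K Q : nat).
Hypothesis Q_gt1 : 1 < Q.
Hypothesis prQ : forall i, i < K -> pr i %| Q.

Definition gnum (s : nat -> nat) := \prod_(i < K) pr i ^ s i.
Definition enc pc s := pc + Q * gnum s.

Lemma eq_gnum s s' : s =1 s' -> gnum s = gnum s'.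
Proof. by move=> E; apply: eq_bigr => i _; rewrite E. Qed.

Lemma gnum_upd s i x : i < K -> gnum (upd s i x) * pr i ^ s i = gnum s * pr i ^ x.
Proof.
move=> Hi; have D t : gnum t = pr i ^ t i * \prod_(j < K | j != Ordinal Hi) pr j ^ t j.
  by rewrite /gnum (bigD1 (Ordinal Hi)).
rewrite !D upd_eq mulnAC [RHS]mulnAC (mulnC (pr i ^ x)); congr (_ * _).
by apply: eq_bigr => j ji; rewrite upd_neq.
Qed.

Lemma gnum_inc s i : i < K -> gnum (upd s i (s i).+1) = pr i * gnum s.
Proof.
move=> Hi; have := gnum_upd s (s i).+1 Hi; rewrite expnS mulnA.
have p0 : 0 < pr i ^ s i by rewrite expn_gt0 prime_gt0 // pr_prime.
by move=> /eqP; rewrite eqn_pmul2r // => /eqP ->; rewrite mulnC.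
Qed.

Lemma gnum_dec s i : i < K -> 0 < s i -> gnum s = pr i * gnum (upd s i (s i).-1).
Proof.
move=> Hi Hs; have := gnum_inc (upd s i (s i).-1) Hi; rewrite upd_eq prednK // => <-.
by apply: eq_gnum => j; rewrite /upd; case: eqP => [->|].
Qed.

(** The other factors are powers of different primes, so divisibility is the zero test of register
    [i]. *)
Lemma dvdn_gnum s i : i < K -> (pr i %| gnum s) = (0 < s i).
Proof.
move=> Hi; case: (posnP (s i)) => [s0|s0]; last by rewrite (gnum_dec Hi s0) dvdn_mulr.
apply/negP; rewrite /gnum; elim/big_ind: _ => //.
- by rewrite Euclid_dvd1 ?pr_prime.
- by move=> x y Hx Hy; rewrite Euclid_dvdM ?pr_prime // => /orP[].
- move=> j _; rewrite Euclid_dvdX ?pr_prime // dvdn_prime2 ?pr_prime //.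
  by move=> /andP[/eqP/pr_inj <-]; rewrite s0.
Qed.

Lemma pr_leQ i : i < K -> 0 < pr i <= Q.
Proof. by move=> /prQ H; rewrite prime_gt0 ?pr_prime // dvdn_leq //; lia. Qed.

(** Since [pr i <= Q], the coefficients are at most [Q ^ 3] and fit into one digit in base
    [Q ^ 4]. *)
Lemma coefA_lt ins w : instr_wf K Q ins -> coefA Q ins w < Q ^ 4.
Proof.
have Q34 : Q ^ 3 < Q ^ 4 by rewrite ltn_exp2l.
case: ins => [i t|i t1 t2] /= /andP[Hi _]; apply: leq_ltn_trans Q34.
  by rewrite (expnSr Q 2) leq_mul2l; have /andP[_ ->] := pr_leQ Hi; rewrite orbT.
case: ifP => _; last by rewrite leq_pexp2l // ltnW.
apply: (@leq_trans (Q ^ 2)); last by rewrite leq_pexp2l // ltnW.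
by rewrite expnS expn1 leq_mul2l leq_div orbT.
Qed.

Lemma coefB_lt ins w : instr_wf K Q ins -> w < Q -> coefB Q ins w < Q ^ 4.
Proof.
have Q34 : Q ^ 3 < Q ^ 4 by rewrite ltn_exp2l.
have bnd t p v : t < Q -> p <= Q -> v < Q -> t + Q * p * v < Q ^ 4.
  move=> Ht Hp Hv; apply: leq_trans Q34; rewrite ltnS.
  apply: (@leq_trans (Q + Q * Q * v)).
    by rewrite leq_add ?(ltnW Ht) // leq_mul2r leq_mul2l Hp !orbT.
  apply: (@leq_trans (Q * Q * v.+1)); last by rewrite !expnS expn0 muln1 mulnA leq_mul2l Hv orbT.
  by rewrite mulnS leq_add2r leq_pmulr // ltnW.
case: ins => [i t|i t1 t2] /=.
  by case/andP=> Hi Ht Hw; apply: bnd => //; case/andP: (pr_leQ Hi).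
case/and3P=> Hi H1 H2 Hw; case: ifP => _.
  have := @bnd t1 1 (w %/ pr i) H1 (ltnW Q_gt1) (leq_ltn_trans (leq_div _ _) Hw).
  by rewrite muln1.
by have := @bnd t2 1 w H2 (ltnW Q_gt1) Hw; rewrite muln1.
Qed.

Variables (P : seq instr) (T : nat).
Let dflt := IInc 0 0.
Hypothesis table : forall r, r < Q ^ 2 ->
  digit (Q ^ 4) T (2 * r) = coefA Q (nth dflt P (r %% Q)) (r %/ Q) /\
  digit (Q ^ 4) T (2 * r + 1) = coefB Q (nth dflt P (r %% Q)) (r %/ Q).

Lemma enc_mod pc s : pc < Q -> enc pc s %% Q = pc.
Proof. by move=> Hpc; rewrite /enc mulnC addnC modnMDl modn_small. Qed.

Lemma cstep_enc pc s : pc < Q -> cstep Q T (enc pc s) =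
  let ins := nth dflt P pc in let w := gnum s %% Q in
  coefA Q ins w * (gnum s %/ Q) + coefB Q ins w.
Proof.
move=> Hpc; have Q0 : 0 < Q by apply: ltnW.
have Er : enc pc s = gnum s %/ Q * Q ^ 2 + (pc + Q * (gnum s %% Q)).
  by rewrite /enc {1}(divn_eq (gnum s) Q) mulnDr addnCA mulnCA mulnA -mulnA mulnC.
have Hr : pc + Q * (gnum s %% Q) < Q ^ 2.
  have := ltn_pmod (gnum s) Q0; rewrite expnS expn1 -(@leq_pmul2l Q) // mulnS.
  by apply: leq_trans; rewrite ltn_add2r.
rewrite /cstep {2}Er divnMDl ?expn_gt0 ?Q0 // (divn_small Hr) addn0.
rewrite Er !modnMDl (modn_small Hr); have [-> ->] := table Hr.
have -> : (pc + Q * (gnum s %% Q)) %% Q = pc by rewrite mulnC addnC modnMDl modn_small.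
by rewrite [pc + _]addnC [Q * _]mulnC divnMDl // (divn_small Hpc) addn0.
Qed.

Lemma cstep_inc pc s i t : pc < Q -> nth dflt P pc = IInc i t -> i < K ->
  cstep Q T (enc pc s) = enc t (upd s i (s i).+1).
Proof.
move=> Hpc E Hi; rewrite cstep_enc // E /= /enc gnum_inc //.
by rewrite {3}(divn_eq (gnum s) Q); move: (_ %/ _) (_ %% _) => a b; lia.
Qed.

(** As [pr i] divides [Q], the residue of the register code mod [Q] already decides the zero
    test. *)
Lemma pr_dvd_mod i v : i < K -> (pr i %| v %% Q) = (pr i %| v).
Proof. by move=> /prQ H; rewrite /dvdn modn_dvdm. Qed.

Lemma cstep_dec0 pc s i t1 t2 : pc < Q -> nth dflt P pc = IDec i t1 t2 -> i < K ->
  s i = 0 -> cstep Q T (enc pc s) = enc t2 s.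
Proof.
move=> Hpc E Hi Hs; rewrite cstep_enc // E /= pr_dvd_mod // dvdn_gnum // Hs /= /enc.
by rewrite {3}(divn_eq (gnum s) Q); move: (_ %/ _) (_ %% _) => a b; lia.
Qed.

Lemma cstep_decS pc s i t1 t2 : pc < Q -> nth dflt P pc = IDec i t1 t2 -> i < K ->
  0 < s i -> cstep Q T (enc pc s) = enc t1 (upd s i (s i).-1).
Proof.
move=> Hpc E Hi Hs; rewrite cstep_enc // E /= pr_dvd_mod // dvdn_gnum // Hs /= /enc.
have p0 : 0 < pr i by rewrite prime_gt0 ?pr_prime.
have -> : gnum (upd s i (s i).-1) = gnum s %/ pr i by rewrite (gnum_dec Hi Hs) mulKn.
rewrite {3}(divn_eq (gnum s) Q) divnDl ?dvdn_mull ?prQ // -muln_divA ?prQ //.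
by move: (_ %% _ %/ _) (gnum s %/ Q) (Q %/ _) => a b c; lia.
Qed.

Lemma nth_code pre c rest : nth dflt (pre ++ c :: rest) (size pre) = c.
Proof. by rewrite nth_cat ltnn subnn. Qed.

(** For the induction the code may sit anywhere in [P], between any [pre] and [post]; [1 < off]
    keeps it clear of the two halting addresses. *)
Lemma reach_code c s s' : run c s s' -> forall off exit pre post,
  P = pre ++ code c off exit ++ post -> size pre = off -> regbound c <= K ->
  size P <= Q -> 1 < off -> reach Q T (enc off s) (enc exit s').
Proof.
have one off s1 n : 1 < off < Q -> cstep Q T (enc off s1) = n -> reach Q T (enc off s1) n.
  by move=> /andP[H1 H2] <-; apply: reach_step (reach_refl _ _ _); rewrite enc_mod.
have offQ pre c0 off exit post : P = pre ++ code c0 off exit ++ post -> size pre = off ->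
    size P <= Q -> off + clen c0 <= Q.
  by move=> -> <-; rewrite !size_cat size_code; lia.
elim=> {c s s'}.
- move=> i s off exit pre post EP Hoff HK HQ H1; have := offQ _ _ _ _ _ EP Hoff HQ => /= Hq.
  apply: one; first by lia.
  by apply: cstep_inc HK; [lia | rewrite EP -Hoff nth_code].
- move=> i s off exit pre post EP Hoff HK HQ H1; have := offQ _ _ _ _ _ EP Hoff HQ => /= Hq.
  apply: one; first by lia.
  have En : nth dflt P off = IDec i exit exit by rewrite EP -Hoff nth_code.
  case: (posnP (s i)) => Hs; last by apply: cstep_decS En _ _ => //; lia.
  (* Decrementing a zero register changes nothing, and both branches lead to [exit]. *)
  rewrite (cstep_dec0 _ En) //; last by lia.
  by rewrite /enc; congr (_ + _ * _); apply: eq_gnum => j; rewrite /upd; case: eqP => // ->; rewrite Hs.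
- move=> c1 c2 s1 s2 s3 _ IH1 _ IH2 off exit pre post /= EP Hoff.
  rewrite geq_max => /andP[K1 K2] HQ H1; apply: (@reach_trans _ _ _ (enc (off + clen c1) s2)).
    by apply: (IH1 _ _ pre (code c2 (off + clen c1) exit ++ post)) => //; rewrite EP -!catA.
  apply: (IH2 _ _ (pre ++ code c1 off (off + clen c1)) post) => //; try lia.
    by rewrite EP -!catA.
  by rewrite size_cat size_code Hoff.
- move=> i c s Hs off exit pre post EP Hoff /=; rewrite geq_max => /andP[Ki _] HQ H1.
  have := offQ _ _ _ _ _ EP Hoff HQ => /= Hq.
  apply: one; first by lia.
  have En : nth dflt P off = IDec i off.+1 exit by rewrite EP -Hoff nth_code.
  by rewrite (cstep_dec0 _ En) //; lia.
- move=> i c s1 s2 s3 Hs _ IH1 _ IH2 off exit pre post EP Hoff HK HQ H1.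
  move: (HK) => /=; rewrite geq_max => /andP[Ki Kc].
  have := offQ _ _ _ _ _ EP Hoff HQ => /= Hq.
  have En : nth dflt P off = IDec i off.+1 exit by rewrite EP -Hoff nth_code.
  apply: (@reach_trans _ _ _ (enc off.+1 (upd s1 i (s1 i).-1))).
    by apply: one; [lia | apply: cstep_decS En _ _ => //; lia].
  apply: (@reach_trans _ _ _ (enc off s2)); last exact: (IH2 _ _ pre post).
  apply: (IH1 _ _ (rcons pre (IDec i off.+1 exit)) post) => //; try lia.
    by rewrite EP /= cat_rcons.
  by rewrite size_rcons Hoff.
Qed.
End Encoding.

Theorem reach_of_prf h : exists Q T, 1 < Q /\ forall x y out, eval h [:: x; y] out ->
  exists n, reach Q T (cinit Q x y) n /\ n %% Q = (out != 0).
Proof.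
pose c := compile h [:: 0; 1] 2 3; pose exit := 2 + clen c; pose dflt := IInc 0 0.
(* The dummies occupy the halting addresses 0 and 1. The last instruction sends a zero result in
   register 2 to address 0 and any other to address 1. *)
pose P := [:: dflt; dflt] ++ code c 2 exit ++ [:: IDec 2 1 0].
pose K := maxn 3 (regbound c).
(* [Q] must be at least the program length, to hold the program counter, and divisible by every
   prime in use. *)
pose Q := (size P) * \prod_(i < K) pr i.
have pr0 : 0 < \prod_(i < K) pr i by apply: prodn_gt0 => i; rewrite prime_gt0 ?pr_prime.
have sP : size P = 3 + clen c by rewrite /P !size_cat size_code /=; lia.
have QP : size P <= Q by rewrite leq_pmulr.
have Q1 : 1 < Q by lia.
have prQ i : i < K -> pr i %| Q.
  by move=> Hi; rewrite /Q (bigD1 (Ordinal Hi)) //= mulnCA dvdn_mulr.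
have K3 : 2 < K by rewrite leq_max.
have Pwf : all (instr_wf K Q) P.
  rewrite /P !all_cat (code_wf (leq_maxr _ _)); [|by rewrite -/c; lia|by rewrite /exit; lia].
  by rewrite /= K3 Q1 (ltnW Q1) (ltnW (ltnW K3)).
have wf i : instr_wf K Q (nth dflt P i).
  case: (ltnP i (size P)) => Hi; first exact: (all_nthP dflt Pwf).
  by rewrite nth_default //= (ltnW (ltnW K3)) (ltnW Q1).
(* Even positions hold the slopes and odd positions the constant terms. *)
pose d i := let r := i %/ 2 in
  (if odd i then coefB else coefA) Q (nth dflt P (r %% Q)) (r %/ Q).
have [T HT] : exists T, forall i, i < 2 * Q ^ 2 -> digit (Q ^ 4) T i = d i.
  apply: digits => i Hi; rewrite /d; case: ifP => _; last by apply: (coefA_lt (K := K)).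
  apply: (coefB_lt (K := K)) => //; rewrite ltn_divLR ?(ltnW Q1) // ltn_divLR //.
  by move: Hi; rewrite mulnC expnS expn1.
have table r : r < Q ^ 2 ->
  digit (Q ^ 4) T (2 * r) = coefA Q (nth dflt P (r %% Q)) (r %/ Q) /\
  digit (Q ^ 4) T (2 * r + 1) = coefB Q (nth dflt P (r %% Q)) (r %/ Q).
  move=> Hr; rewrite !HT; [|lia|lia]; rewrite /d !mul2n odd_double !divn2 doubleK.
  by rewrite addn1 /= odd_double /= uphalf_double.
exists Q, T; split=> // x y out Hev.
pose s i := if i == 0 then x else if i == 1 then y else 0.
have [|||| s' [R Es' _]] := compile_correct Hev (ins := [:: 0; 1]) (o := 2) (b := 3) (s := s) => //.
have Einit : cinit Q x y = enc K Q 2 s.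
  (* This exposes the factors of registers 0 and 1; all others have exponent 0. *)
  have EK : K = K.-2.+2 by lia.
  rewrite /cinit /enc /gnum EK.
  rewrite !big_ord_recl big1 ?muln1 // => i _; by rewrite /s.
have Hrun := reach_code Q1 prQ table R (off := 2) (exit := exit) (pre := [:: dflt; dflt])
  (post := [:: IDec 2 1 0]) erefl erefl (leq_maxr _ _) QP isT.
have Eex : nth dflt P exit = IDec 2 1 0.
  rewrite /P catA nth_cat size_cat size_code /= ltnn subnn //.
have exQ : exit < Q by rewrite /exit; lia.
exists (enc K Q (out != 0) (if out == 0 then s' else upd s' 2 (s' 2).-1)); split; last first.
  by rewrite enc_mod //; case: (out == 0) => //; apply: ltnW.
rewrite Einit; apply: reach_trans Hrun _; apply: reach_step; first by rewrite enc_mod.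
case: eqP => Eo; [rewrite (cstep_dec0 Q1 prQ table exQ Eex) ?Es' //
  | rewrite (cstep_decS Q1 prQ table exQ Eex) ?Es' //];
  try (exact: reach_refl); lia.
Qed.

(** * A universal function *)

Lemma computable_digit n B T I : computable n B -> computable n T -> computable n I ->
  computable n (fun xs => digit (B xs) (T xs) (I xs)).
Proof.
by move=> HB HT HI; exact: (computable_mod (computable_div HT (computable_exp HB HI)) HB).
Qed.

Lemma computable_cstep n Q T N : computable n Q -> computable n T -> computable n N ->
  computable n (fun xs => cstep (Q xs) (T xs) (N xs)).
Proof.
move=> HQ HT HN; have cst k := computable_const n k.
have HQ2 := computable_exp HQ (cst 2); have HQ4 := computable_exp HQ (cst 4).
have Hr := computable_mul (cst 2) (computable_mod HN HQ2).
exact: (computable_add (computable_mul (computable_digit HQ4 HT Hr) (computable_div HN HQ2))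
  (computable_digit HQ4 HT (computable_add Hr (cst 1)))).
Qed.

Lemma computable_cinit n Q X Y : computable n Q -> computable n X -> computable n Y ->
  computable n (fun xs => cinit (Q xs) (X xs) (Y xs)).
Proof.
move=> HQ HX HY; have cst k := computable_const n k.
exact: (computable_add (cst 2) (computable_mul HQ
  (computable_mul (computable_exp (cst (pr 0)) HX) (computable_exp (cst (pr 1)) HY)))).
Qed.

Lemma reach_iter Q T n n' : reach Q T n n' ->
  exists t, n' = iter t (cstep Q T) n /\ forall u, u < t -> 1 < iter u (cstep Q T) n %% Q.
Proof.
elim=> [m|m m' Hm _ [t [-> Ht]]]; first by exists 0.
exists t.+1; split; first by rewrite iterSr.
by case=> // u Hu; rewrite iterSr; apply: Ht.
Qed.

(** Minimisation finds the first time [t] at which the residue minus 1, truncated, is 0, that is, at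
    which the map has halted. The map is started on its own code, as the diagonal argument
    demands. *)
Lemma universal_prf : exists U, forall Q T n, reach Q T (cinit Q Q T) n ->
  n %% Q <= 1 -> eval U [:: Q; T] (n %% Q).
Proof.
have proj i : i < 4 -> computable 4 (fun xs => nth 0 xs i) by apply: computable_proj.
have proj3 i : i < 3 -> computable 3 (fun xs => nth 0 xs i) by apply: computable_proj.
have proj2 i : i < 2 -> computable 2 (fun xs => nth 0 xs i) by apply: computable_proj.
have Hiter : computable 3 (fun xs => iter (nth 0 xs 0) (cstep (nth 0 xs 1) (nth 0 xs 2))
    (cinit (nth 0 xs 1) (nth 0 xs 1) (nth 0 xs 2))).
  have := computable_rec (computable_cinit (proj2 0 isT) (proj2 0 isT) (proj2 1 isT))
    (computable_cstep (proj 2 isT) (proj 3 isT) (proj 1 isT)).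
  by move/computable_ext; apply; comp_ext; elim: x0 => //= x0 ->.
have Hmod := computable_mod Hiter (proj3 1 isT).
have [p Hp] := computable_sub Hmod (computable_const 3 1).
have [q Hq] := Hmod.
exists (PComp q [:: PMu p; PProj 0; PProj 1]) => Q T n /reach_iter[t [-> Ht]] Hle.
apply: (ev_comp (ys := [:: t; Q; T])); last exact: Hq.
constructor; last by repeat constructor.
apply: ev_mu.
  have := Hp [:: t; Q; T] erefl => /=.
  by have -> : iter t (cstep Q T) (cinit Q Q T) %% Q - 1 = 0 by lia.
move=> u Hu; exists (iter u (cstep Q T) (cinit Q Q T) %% Q - 2).
have := Hp [:: u; Q; T] erefl => /=.
by have -> : iter u (cstep Q T) (cinit Q Q T) %% Q - 1 =
   (iter u (cstep Q T) (cinit Q Q T) %% Q - 2).+1 by have := Ht _ Hu; lia.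
Qed.

(** * Monoids given by normal forms, and the monoid of a queue machine *)

Section Congruence.
Variables (X : eqType) (rels : seq (seq X * seq X)).
Local Notation cong := (cong_gen rels).

Lemma cong_rel p q l r : (l, r) \in rels -> cong (p ++ l ++ q) (p ++ r ++ q).
Proof.
move=> Hin; have := @cg_rule _ rels p q (index (l, r) rels).
by rewrite index_mem Hin nth_index //; apply.
Qed.

Lemma cong_ctx p q u v : cong u v -> cong (p ++ u ++ q) (p ++ v ++ q).
Proof.
elim=> [w|w1 w2 _ IH|w1 w2 w3 _ IH1 _ IH2|p' q' i Hi l r].
- exact: cg_refl.
- exact: cg_sym.
- exact: cg_trans IH1 IH2.
- have H := cg_rule (p ++ p') (q' ++ q) Hi; rewrite /= -!catA in H *; exact: H.
Qed.

Lemma cong_catr q u v : cong u v -> cong (u ++ q) (v ++ q).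
Proof. exact: (@cong_ctx [::]). Qed.

Lemma cong_catl p u v : cong u v -> cong (p ++ u) (p ++ v).
Proof. by move/(@cong_ctx p [::]); rewrite !cats0. Qed.

Variable rho : seq X -> seq X.
Hypothesis cong_rho : forall u, cong (rho u) u.
Hypothesis rho_cong : forall u v, cong u v -> rho u = rho v.

(** The quotient of the free monoid is realised on the fixed points of [rho], so that congruent
    words give equal elements without quotient types. *)
Definition nf_carrier := {u : seq X | rho u == u}.

Lemma rhoK u : rho (rho u) = rho u. Proof. exact: rho_cong. Qed.

Definition nf_of u : nf_carrier := exist _ (rho u) (introT eqP (rhoK u)).

Lemma nf_of_val (s : nf_carrier) : nf_of (val s) = s.
Proof. by apply: val_inj; apply/eqP; apply: (valP s). Qed.

Lemma nf_of_eq u v : nf_of u = nf_of v <-> cong u v.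
Proof.
split=> [/(congr1 val) /= E|/rho_cong E]; last exact: val_inj.
by apply: cg_trans (cg_sym (cong_rho u)) _; rewrite E; apply: cong_rho.
Qed.

Definition nf_mul (s t : nf_carrier) := nf_of (val s ++ val t).

Lemma nf_mul_of u v : nf_mul (nf_of u) (nf_of v) = nf_of (u ++ v).
Proof.
apply/nf_of_eq; apply: cg_trans (cong_catr _ (cong_rho u)) _.
exact: cong_catl (cong_rho v).
Qed.

Lemma nf_mulA s t u : nf_mul s (nf_mul t u) = nf_mul (nf_mul s t) u.
Proof. by rewrite -(nf_of_val s) -(nf_of_val t) -(nf_of_val u) !nf_mul_of catA. Qed.

Lemma nf_mul1l s : nf_mul (nf_of [::]) s = s.
Proof. by rewrite -(nf_of_val s) nf_mul_of. Qed.

Lemma nf_mul1r s : nf_mul s (nf_of [::]) = s.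
Proof. by rewrite -(nf_of_val s) nf_mul_of cats0. Qed.

Definition nf_monoid : monoid :=
  @Defs.Monoid nf_carrier nf_mul (nf_of [::]) nf_mulA nf_mul1l nf_mul1r.

Lemma nf_of_morphism : is_morphism (nf_of : seq X -> nf_monoid).
Proof. by split=> // u v; rewrite -nf_mul_of. Qed.
End Congruence.

Lemma cong_gen_map (X Y : eqType) (f : X -> Y) rels u v : cong_gen rels u v ->
  cong_gen [seq (map f p.1, map f p.2) | p <- rels] (map f u) (map f v).
Proof.
elim=> [w|w1 w2 _ IH|w1 w2 w3 _ IH1 _ IH2|p q i Hi l r].
- exact: cg_refl.
- exact: cg_sym.
- exact: cg_trans IH1 IH2.
- rewrite !map_cat; apply: cong_rel; apply/mapP.
  by exists (nth ([::], [::]) rels i) => //; apply: mem_nth.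
Qed.

(** Finite presentations are over alphabets ['I_n], so generators and relations are renamed by
    rank. *)
Lemma finitely_presented_nf (X : finType) rels rho
    (H1 : forall u : seq X, cong_gen rels (rho u) u)
    (H2 : forall u v, cong_gen rels u v -> rho u = rho v) :
  finitely_presented (nf_monoid H1 H2).
Proof.
pose f := @enum_rank X; pose g : 'I_#|X| -> X := enum_val.
have fK : cancel f g by apply: enum_rankK.
have gK : cancel g f by apply: enum_valK.
have [nil_m cat_m] := nf_of_morphism H1 H2.
exists #|X|, [seq (map f p.1, map f p.2) | p <- rels].
exists (fun u => nf_of H1 H2 (map g u)).
split; first by split=> [//|u v]; rewrite map_cat cat_m.
split=> [s|u v]; first by exists (map f (val s)); rewrite mapK // nf_of_val.
rewrite nf_of_eq; split=> [/(cong_gen_map f)|/(cong_gen_map g)]; first by rewrite !mapK.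
rewrite -map_comp (eq_map (g := id)) ?map_id // => -[l r] /=.
by rewrite !mapK.
Qed.

(** * The presentation attached to a queue machine and its normal forms *)

Section QueueMonoid.
Variables A S : finType.

Inductive qinstr := QPush (a : A) (s : S) | QPop (k : A -> S) | QStop.

(** [Sh] opens the block that holds the queue, [Dl] carries the state, [Tk] asks for one
    instruction, and [En] erases a bare [Sh] or the halting [Dl]. *)
Inductive sep := Sh | En | Dl (s : S) | Tk (a : A).
Inductive gen := Lt (a : A) | Pp (a : A) | Sp (c : sep).

Definition sep_enc c : bool + (S + A) :=
  match c with Sh => inl true | En => inl false | Dl s => inr (inl s) | Tk a => inr (inr a) end.
Definition sep_dec c :=
  match c with inl true => Sh | inl false => En | inr (inl s) => Dl s | inr (inr a) => Tk a end.
Lemma sep_encK : cancel sep_enc sep_dec. Proof. by case. Qed.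
HB.instance Definition _ := Countable.copy sep (can_type sep_encK).
HB.instance Definition _ : isFinite sep := CanIsFinite sep_encK.

Definition gen_enc g : A + A + sep :=
  match g with Lt a => inl (inl a) | Pp a => inl (inr a) | Sp c => inr c end.
Definition gen_dec g :=
  match g with inl (inl a) => Lt a | inl (inr a) => Pp a | inr c => Sp c end.
Lemma gen_encK : cancel gen_enc gen_dec. Proof. by case. Qed.
HB.instance Definition _ := Countable.copy gen (can_type gen_encK).
HB.instance Definition _ : isFinite gen := CanIsFinite gen_encK.

Variables (act : S -> qinstr) (h : S).

(** For a pop the token is a guess of the front letter; for a push its letter has no effect. A wrong
    guess shows only when the pop faces a different letter at [Sh]. The boolean is [true] for a
    push. *)
Definition tr s a :=
  match act s with
  | QPush x s' => Some (true, x, s')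
  | QPop k => Some (false, a, k a)
  | QStop => None
  end.

Definition opgen (op : bool * A) := if op.1 then Lt op.2 else Pp op.2.

(** Where no instruction exists, the trivial relation fills the entry. *)
Definition rule_rel (p : S * A) :=
  if tr p.1 p.2 is Some (op, s') then
    ([:: Sp (Dl p.1); Sp (Tk p.2)], [:: opgen op; Sp (Dl s')]) else ([::], [::]).

Definition qrels :=
  [seq ([:: Lt p.1; Pp p.2], [:: Pp p.2; Lt p.1]) | p <- enum {: A * A}] ++
  [seq ([:: Sp Sh; Lt a; Pp a], [:: Sp Sh]) | a <- enum A] ++
  [seq rule_rel p | p <- enum {: S * A}] ++
  [:: ([:: Sp Sh; Sp En], [::]); ([:: Sp (Dl h); Sp En], [::])].

Local Notation cong := (cong_gen qrels).

(** A stack of blocks, growing to the right, between separators: [x] lists the letters and [w] the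
    pops of a block. Right multiplication thus acts near the top. *)
Inductive nfs := Bot (x w : seq A) | Fr (b : nfs) (c : sep) (x w : seq A).

Fixpoint strip (x w : seq A) :=
  match x, w with
  | a :: x', b :: w' => if a == b then strip x' w' else (x, w)
  | _, _ => (x, w)
  end.

Definition ext (op : bool * A) (p : seq A * seq A) :=
  if op.1 then (rcons p.1 op.2, p.2) else (p.1, rcons p.2 op.2).

Definition norm c (p : seq A * seq A) := if c is Sh then strip p.1 p.2 else p.

Definition addop op s :=
  match s with
  | Bot x w => let p := ext op (x, w) in Bot p.1 p.2
  | Fr b c x w => let p := norm c (ext op (x, w)) in Fr b c p.1 p.2
  end.

Definition red s c :=
  match c, s with
  | En, Fr b Sh [::] [::] => Some b
  | En, Fr b (Dl q) [::] [::] => if q == h then Some b else None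
  | Tk t, Fr b (Dl q) [::] [::] =>
      if tr q t is Some (op, q') then Some (Fr (addop op b) (Dl q') [::] [::]) else None
  | _, _ => None
  end.

Definition step s g :=
  match g with
  | Lt a => addop (true, a) s
  | Pp a => addop (false, a) s
  | Sp c => odflt (Fr s c [::] [::]) (red s c)
  end.

Definition block x w := map Lt x ++ map Pp w.

Fixpoint word s :=
  match s with
  | Bot x w => block x w
  | Fr b c x w => word b ++ Sp c :: block x w
  end.

Definition nf := foldl step (Bot [::] [::]).
Definition rho u := word (nf u).

Lemma step_opgen s op : step s (opgen op) = addop op s.
Proof. by case: op => -[]. Qed.

(** Cancellation proceeds from the left, so it may be done before or after appending on the
    right. *)
Lemma strip_cat x w x' w' : strip (x ++ x') (w ++ w') =
  strip ((strip x w).1 ++ x') ((strip x w).2 ++ w').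
Proof. by elim: x w => [|a x IH] [|b w] //=; case: ifP => E //=; rewrite E. Qed.

Lemma norm_ext c op p : norm c (ext op (norm c p)) = norm c (ext op p).
Proof.
case: c => //; case: op => -[] a; rewrite /ext /= -!cats1.
  by have := strip_cat p.1 p.2 [:: a] [::]; rewrite !cats0.
by have := strip_cat p.1 p.2 [::] [:: a]; rewrite !cats0.
Qed.

Lemma addop_comm a b s :
  addop (true, a) (addop (false, b) s) = addop (false, b) (addop (true, a) s).
Proof.
case: s => // s c x w.
have two op1 op2 : addop op1 (addop op2 (Fr s c x w)) =
    let p := norm c (ext op1 (ext op2 (x, w))) in Fr s c p.1 p.2.
  by rewrite /= -surjective_pairing norm_ext.
by rewrite !two.
Qed.

(** Both sides of a relation act alike, so the presented monoid acts on stacks from the right. This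
    takes the place of a confluence check and makes [rho] constant on congruence classes. *)
Lemma foldl_step_rel s l r : (l, r) \in qrels -> foldl step s l = foldl step s r.
Proof.
rewrite !mem_cat => /or4P[/mapP[[a b] _ [-> ->]]|/mapP[a _ [-> ->]]|/mapP[[q a] _]|].
- by rewrite /= addop_comm.
- by rewrite /= eqxx.
- rewrite /rule_rel /=; case E: (tr q a) => [[op q']|] [-> ->] //=.
  by rewrite E /= step_opgen; case: (addop op s).
- by rewrite !inE => /orP[] /eqP[-> ->] //=; rewrite eqxx.
Qed.

Lemma foldl_step_cong u v : cong u v -> forall s, foldl step s u = foldl step s v.
Proof.
elim=> [//|w1 w2 _ IH s|w1 w2 w3 _ IH1 _ IH2 s|p q i Hi l r s]; rewrite ?IH ?IH1 //.
have Hin : (l, r) \in qrels by rewrite /l /r -surjective_pairing; apply: mem_nth.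
by rewrite !foldl_cat (foldl_step_rel _ Hin).
Qed.

Lemma rho_cong u v : cong u v -> rho u = rho v.
Proof. by move=> H; rewrite /rho /nf (foldl_step_cong H). Qed.

Lemma cong_swap a b p q : cong (p ++ Lt a :: Pp b :: q) (p ++ Pp b :: Lt a :: q).
Proof.
apply: (cong_rel p q (l := [:: _; _]) (r := [:: _; _])).
by rewrite mem_cat; apply/orP; left; apply/mapP; exists (a, b); rewrite ?mem_enum.
Qed.

Lemma cong_cancel a p q : cong (p ++ Sp Sh :: Lt a :: Pp a :: q) (p ++ Sp Sh :: q).
Proof.
apply: (cong_rel p q (l := [:: _; _; _]) (r := [:: _])).
by rewrite !mem_cat map_f ?mem_enum ?orbT.
Qed.

Lemma cong_rule s a op s' p q : tr s a = Some (op, s') ->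
  cong (p ++ Sp (Dl s) :: Sp (Tk a) :: q) (p ++ opgen op :: Sp (Dl s') :: q).
Proof.
move=> E; apply: (cong_rel p q (l := [:: _; _]) (r := [:: _; _])); rewrite !mem_cat.
have -> : ([:: Sp (Dl s); Sp (Tk a)], [:: opgen op; Sp (Dl s')]) = rule_rel (s, a).
  by rewrite /rule_rel E.
by rewrite (map_f rule_rel) ?mem_enum ?orbT.
Qed.

Lemma cong_end p q : cong (p ++ Sp Sh :: Sp En :: q) (p ++ q).
Proof.
apply: (cong_rel p q (l := [:: _; _]) (r := [::])).
by rewrite !mem_cat !inE eqxx !orbT.
Qed.

Lemma cong_halt p q : cong (p ++ Sp (Dl h) :: Sp En :: q) (p ++ q).
Proof.
apply: (cong_rel p q (l := [:: _; _]) (r := [::])).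
by rewrite !mem_cat !inE eqxx !orbT.
Qed.

Lemma cong_pass w a p q : cong (p ++ map Pp w ++ Lt a :: q) (p ++ Lt a :: map Pp w ++ q).
Proof.
elim: w p => [|b w IH] p /=; first exact: cg_refl.
have := IH (rcons p (Pp b)); rewrite !cat_rcons => H; apply: cg_trans H _.
exact: cg_sym (cong_swap a b p (map Pp w ++ q)).
Qed.

Lemma cong_ext op x w p q :
  cong (p ++ block x w ++ opgen op :: q) (p ++ block (ext op (x, w)).1 (ext op (x, w)).2 ++ q).
Proof.
case: op => -[] a; rewrite /block /ext /= map_rcons -cats1 -!catA; last exact: cg_refl.
by rewrite !catA -catA -[in X in cong _ X]catA -[in X in cong _ X]catA; apply: cong_pass.
Qed.

Lemma cong_pass_left b x p q : cong (p ++ map Lt x ++ Pp b :: q) (p ++ Pp b :: map Lt x ++ q).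
Proof.
elim: x p => [|a x IH] p /=; first exact: cg_refl.
have := IH (rcons p (Lt a)); rewrite !cat_rcons => H; apply: cg_trans H _.
exact: cong_swap.
Qed.

(** The first pop travels left over all letters but the first, which it then cancels next to
    [Sh]. *)
Lemma cong_strip x w p q : cong (p ++ Sp Sh :: block x w ++ q)
  (p ++ Sp Sh :: block (strip x w).1 (strip x w).2 ++ q).
Proof.
elim: x w => [|a x IH] [|b w] /=; try exact: cg_refl.
case: eqP => [->|_] /=; last exact: cg_refl.
apply: cg_trans (IH w); apply: cg_trans (cong_cancel b p (block x w ++ q)).
have := cong_pass_left b x (p ++ [:: Sp Sh; Lt b]) (map Pp w ++ q).
by rewrite /block -!catA.
Qed.

Lemma cong_norm c op x w p q :
  cong (p ++ Sp c :: block x w ++ opgen op :: q)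
    (p ++ Sp c :: block (norm c (ext op (x, w))).1 (norm c (ext op (x, w))).2 ++ q).
Proof.
have := cong_ext op x w (rcons p (Sp c)) q; rewrite !cat_rcons => H.
by apply: cg_trans H _; case: c => //= *; try exact: cg_refl; apply: cong_strip.
Qed.

Lemma cong_addop op s : cong (word (addop op s)) (word s ++ [:: opgen op]).
Proof.
apply: cg_sym; case: s => [x w|s c x w] /=.
  by have := cong_ext op x w [::] [::]; rewrite cats0.
have := cong_norm c op x w (word s) [::]; rewrite cats0 => H; rewrite -catA; exact: H.
Qed.

Lemma cong_red s c s' : red s c = Some s' -> cong (word s') (word s ++ [:: Sp c]).
Proof.
move=> H; apply: cg_sym; case: c H => [||q|t] //; case: s => // s [||q|t'] //= [|? ?] [|? ?] //.
- by move=> [<-]; have := cong_end (word s) [::]; rewrite cats0 -catA.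
- by case: eqP => // -> [<-]; have := cong_halt (word s) [::]; rewrite cats0 -catA.
- case E: (tr q t) => [[op q']|] // [<-] /=.
  have := cong_rule (word s) [::] E; rewrite -catA /= => H; apply: cg_trans H _.
  have := cong_catr [:: Sp (Dl q')] (cong_addop op s); rewrite -catA => H.
  exact: cg_sym H.
Qed.

Lemma cong_step s g : cong (word (step s g)) (word s ++ [:: g]).
Proof.
case: g => [a|a|c] /=; [exact: cong_addop (true, a) s|exact: cong_addop (false, a) s|].
case E: red => [s'|] /=; first exact: cong_red.
exact: cg_refl.
Qed.

Lemma cong_rho u : cong (rho u) u.
Proof.
elim/last_ind: u => [|u g IH]; first exact: cg_refl.
rewrite /rho /nf -cats1 foldl_cat /=; apply: cg_trans (cong_step _ _) _.
exact: cong_catr.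
Qed.

Definition qmonoid := nf_monoid cong_rho rho_cong.

End QueueMonoid.

Arguments QStop {A S}.
Arguments Sh {A S}.
Arguments En {A S}.
Arguments Dl {A S} s.
Arguments Tk {A S} a.
Arguments Lt {A S} a.
Arguments Pp {A S} a.
Arguments Bot {A S} x w.
Arguments opgen {A S} op.
Arguments block {A S} x w.

(** * Closure properties of synchronously regular relations *)

Section Powerset.
Variables (B : Type) (Q : finType) (q0 : Q) (delta : Q -> B -> pred Q) (fin : pred Q).

(** Nondeterministic acceptance, wanted because the automaton of [shift_rel] guesses where the two
    words part. *)
Fixpoint nacc q x := if x is b :: x' then [exists q', delta q b q' && nacc q' x'] else fin q.

Definition powerset_dfa : dfa B :=
  @Dfa B {set Q} [set q0] (fun P => [exists q in P, fin q])
    (fun P b => [set q' | [exists q in P, delta q b q']]).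

Lemma powersetP x : accepts powerset_dfa x = nacc q0 x.
Proof.
rewrite /accepts /=; set t := fun (P : {set Q}) b => _.
have -> : nacc q0 x = [exists q in [set q0], nacc q x].
  apply/idP/exists_inP => [H|[q]]; first by exists q0; rewrite ?inE.
  by rewrite inE => /eqP ->.
elim: x [set q0] => [//|b x IH] P /=; rewrite IH.
apply/exists_inP/exists_inP => [[q']|[q HP /existsP[q' /andP[Hd Hx]]]].
  rewrite inE => /exists_inP[q HP Hd] Hx; exists q => //.
  by apply/existsP; exists q'; rewrite Hd.
by exists q' => //; rewrite inE; apply/exists_inP; exists q.
Qed.
End Powerset.

Section Pads.
Variable G : finType.
Implicit Types u v : seq G.

Lemma pad_cons a b u v : pad (a :: u) (b :: v) = (Some a, Some b) :: pad u v.
Proof. by rewrite /pad /mkseq /= maxnSS /= (iotaDl 1) -map_comp. Qed.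

Lemma pad_consl a u : pad (a :: u) [::] = (Some a, None) :: pad u [::].
Proof.
rewrite /pad /mkseq !maxn0 /= (iotaDl 1) -map_comp; congr cons.
by apply: eq_map => i; case: i.
Qed.

Lemma pad_consr b v : pad [::] (b :: v) = (None, Some b) :: pad [::] v.
Proof.
rewrite /pad /mkseq !max0n /= (iotaDl 1) -map_comp; congr cons.
by apply: eq_map => i; case: i.
Qed.

Definition swap (p : option G * option G) := (p.2, p.1).

Lemma pad_swap u v : map swap (pad u v) = pad v u.
Proof.
have E w : map swap (pad [::] w) = pad w [::].
  by elim: w => // b w IH; rewrite pad_consl pad_consr /= IH.
have E' w : map swap (pad w [::]) = pad [::] w.
  by elim: w => // b w IH; rewrite pad_consl pad_consr /= IH.
by elim: u v => [|a u IH] [|b v]; rewrite ?E ?E' // !pad_cons /= IH.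
Qed.

Lemma pmap_pad u v : pmap fst (pad u v) = u.
Proof.
elim: u v => [|a u IH] [|b v] //; rewrite ?pad_cons ?pad_consl ?pad_consr /= ?IH //.
by elim: v => // b' v IH; rewrite pad_consr.
Qed.

(** A [sig] type instead of an existential, so that the automata of all generators can be gathered
    into a function. *)
Definition regular_rel (R : seq G -> seq G -> Prop) := {M : dfa _ | recognizes_rel M R}.

Lemma regular_ext R R' : (forall u v, R u v <-> R' u v) -> regular_rel R -> regular_rel R'.
Proof.
move=> E [M HM]; exists M => x; split=> [/HM|] [u [v [/E H ->]]]; first by exists u, v.
by apply/HM; exists u, v.
Qed.

Lemma regular_or R R' : regular_rel R -> regular_rel R' ->
  regular_rel (fun u v => R u v \/ R' u v).
Proof.
move=> [M HM] [M' HM'].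
exists (@Dfa _ (dstate M * dstate M')%type (dstart M, dstart M')
  (fun q => dfinal q.1 || dfinal q.2) (fun q b => (dtrans q.1 b, dtrans q.2 b))).
have E x p : foldl (fun (q : dstate M * dstate M') b => (dtrans q.1 b, dtrans q.2 b)) p x
    = (foldl (@dtrans _ M) p.1 x, foldl (@dtrans _ M') p.2 x).
  by elim: x p => [[]|b x IH p] //=; rewrite IH.
move=> x; rewrite /accepts /= E /=; split.
  by case/orP => [/HM|/HM'] [u [v [H ->]]]; exists u, v; split; auto.
case=> u [v [[H|H] ->]]; apply/orP; [left; apply/HM | right; apply/HM']; by exists u, v.
Qed.

Lemma regular_false : regular_rel (fun _ _ => False).
Proof.
exists (@Dfa _ unit tt xpred0 (fun _ _ => tt)) => x; split=> //.
by case=> u [v []].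
Qed.

Lemma regular_bigor (I : finType) (R : I -> seq G -> seq G -> Prop) :
  (forall i, regular_rel (R i)) -> regular_rel (fun u v => exists i, R i u v).
Proof.
move=> HR; suff: regular_rel (fun u v => exists2 i, i \in enum I & R i u v).
  apply: regular_ext => u v; split=> [[i _ H]|[i H]]; exists i => //; by rewrite mem_enum.
elim: (enum I) => [|i s IH].
  by apply: regular_ext regular_false => u v; split=> // -[].
apply: regular_ext (regular_or (HR i) IH) => u v; split.
  by case=> [H|[j Hj H]]; [exists i | exists j] => //; rewrite inE ?eqxx ?Hj ?orbT.
by case=> j; rewrite inE => /orP[/eqP->|Hj] H; [left | right; exists j].
Qed.

Lemma regular_swap R : regular_rel R -> regular_rel (fun u v => R v u).
Proof.
case=> M HM; exists (@Dfa _ (dstate M) (dstart M) (@dfinal _ M) (fun q b => dtrans q (swap b))).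
have E x q : foldl (fun q b => dtrans q (swap b)) q x = foldl (@dtrans _ M) q (map swap x).
  by elim: x q => //= b x IH q; rewrite IH.
have swapK (x : seq (option G * option G)) : map swap (map swap x) = x.
  by rewrite -map_comp -[RHS]map_id; apply: eq_map => -[].
move=> x; rewrite /accepts /= E; split.
  by move/HM=> [u [v [H Ex]]]; exists v, u; rewrite -pad_swap -Ex swapK.
by case=> u [v [H ->]]; apply/HM; exists v, u; rewrite pad_swap.
Qed.

Lemma regular_and R (L L' : dfa G) : regular_rel R ->
  regular_rel (fun u v => [/\ accepts L u, accepts L' v & R u v]).
Proof.
(* [opt] lets the automata of the two components stand still on padding. *)
case=> M HM; pose opt (N : dfa G) q o := if o is Some a then @dtrans _ N q a else q.
exists (@Dfa _ (dstate M * (dstate L * dstate L'))%type (dstart M, (dstart L, dstart L'))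
  (fun q => [&& dfinal q.1, dfinal q.2.1 & dfinal q.2.2])
  (fun q b => (dtrans q.1 b, (opt L q.2.1 b.1, opt L' q.2.2 b.2)))).
set t := fun (q : dstate M * (dstate L * dstate L')) b => _.
have E x p : foldl t p x = (foldl (@dtrans _ M) p.1 x, (foldl (@dtrans _ L) p.2.1 (pmap fst x),
    foldl (@dtrans _ L') p.2.2 (pmap snd x))).
  by elim: x p => [[? []]|[b1 b2] x IH p] //=; rewrite IH; case: b1 b2 => [?|] [?|].
have pmap_snd u v : pmap snd (pad u v) = v.
  rewrite -[RHS](pmap_pad v u) -pad_swap.
  by elim: (pad v u) => //= -[[?|] [?|]] x /= ->.
move=> x; rewrite /accepts /= E /=; split.
  case/and3P=> /HM [u [v [H ->]]]; rewrite pmap_pad pmap_snd => HL HL'.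
  by exists u, v.
case=> u [v [[HL HL' H] ->]]; rewrite pmap_pad pmap_snd; apply/and3P; split=> //.
by apply/HM; exists u, v.
Qed.

Lemma regular_diag : regular_rel (fun u v => u = v).
Proof.
exists (@Dfa _ bool true id (fun q b => [&& q, b.1 == b.2 & b.1 != None])).
have E x : foldl (fun q (b : option G * option G) => [&& q, b.1 == b.2 & b.1 != None]) false x
  = false by elim: x.
move=> x; rewrite /accepts /=; split.
  elim: x => [|[[a|] b] x IH] /=; rewrite ?andbF ?E //; first by exists [::], [::].
  case: eqP => [<-|]; rewrite /= ?E // => /IH [u [v [-> ->]]].
  by exists (a :: v), (a :: v); rewrite pad_cons.
by case=> u [v [-> ->]]; elim: v => //= a v; rewrite pad_cons /= eqxx.
Qed.

(** * Recognising the deletion of one letter *)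

Section Shift.
Variables (Y : dfa G) (c : G) (P : pred G) (last : option (G * G)).

Inductive tails : seq G -> seq G -> Prop :=
| tails_nil : last = None -> tails [::] [::]
| tails_end g g' : last = Some (g, g') -> tails [:: g] [:: g']
| tails_cons a z z' : P a -> tails z z' -> tails (a :: z) (a :: z').

(** Right multiplication by a generator will be a union of such relations and their converses: one
    letter goes, the rest moves by one place, and at most the last letter changes. *)
Definition shift_rel u v := exists y z z',
  [/\ accepts Y y, tails z z', u = y ++ c :: z & v = y ++ z'].

(* After [c], the state keeps the last letter read in the second word, which the first
   word has to produce next. *)
Let Q := (dstate Y + bool * option G)%type.

(** [inl p] is used on the common prefix, with [Y] in state [p]. In [inr (d, o)], [o] is the pending
    letter and [d] records that the exceptional last pair has been read, after which the input must
    end. *)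
Let delta (q : Q) (b : option G * option G) (q' : Q) : bool :=
  match q, b.1 with
  | inl p, Some a =>
      ((b.2 == Some a) && (q' == inl (dtrans p a))) ||
      [&& a == c, dfinal p & q' == inr (false, b.2)]
  | inr (false, Some a'), Some a =>
      [&& a == a', P a & q' == inr (false, b.2)] ||
      ((last == Some (a, a')) && (q' == inr (true, b.2)))
  | _, _ => false
  end.

Let fin (q : Q) := if q is inr (d, None) then d == (last != None) else false.

Local Notation acc := (nacc delta fin).

Lemma acc_end o x : acc (inr (true, o)) x -> x = [::] /\ o = None.
Proof. by case: x => [|b x] /=; [case: o | case/existsP]. Qed.

(** After the deleted letter the second word is one letter ahead: its head is in the state, so only
    [behead z'] is still to be read. *)
Lemma acc_tailsP o x : acc (inr (false, o)) x <->
  exists z z', [/\ tails z z', o = ohead z' & x = pad z (behead z')].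
Proof.
split.
  elim: x o => [|[b1 b2] x IH] o /=.
    case: o => //; case El: last => //= _; exists [::], [::]; split=> //; exact: tails_nil.
  case/existsP=> q' /andP[]; case: o b1 => [a'|] [a|] //=.
  case/orP=> [/and3P[/eqP<- Pa /eqP->]|/andP[/eqP El /eqP->]].
    case/IH=> z [z' [Hz -> ->]]; exists (a :: z), (a :: z'); split=> //.
      exact: tails_cons.
    by case: z' {Hz} => [|b z'] /=; rewrite ?pad_cons ?pad_consl.
  case/acc_end=> -> ->; exists [:: a], [:: a']; split=> //; exact: tails_end.
case=> z [z' [Hz -> ->]]; elim: Hz => {z z'} [E|g g' E|a z z' Pa _ IH].
- by rewrite /= E.
- rewrite [behead _]/= pad_consl; apply/existsP; exists (inr (true, None)).
  by rewrite /= E !eqxx orbT.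
- rewrite [behead _]/= [ohead _]/=; have -> : pad (a :: z) z' = (Some a, ohead z') :: pad z (behead z').
    by case: z' {IH} => [|b z'] /=; rewrite ?pad_cons ?pad_consl.
  by apply/existsP; exists (inr (false, ohead z')); rewrite /= !eqxx Pa.
Qed.

Lemma acc_shiftP q x : acc (inl q) x <-> exists y z z',
  [/\ dfinal (foldl (@dtrans _ Y) q y), tails z z' & x = pad (y ++ c :: z) (y ++ z')].
Proof.
split.
  elim: x q => [|[[a|] b2] x IH] q //=; last by case/existsP.
  case/existsP=> q' /andP[].
  case/orP=> [/andP[/eqP-> /eqP->]|/and3P[/eqP-> Hq /eqP->]].
    case/IH=> y [z [z' [Hy Hz ->]]]; exists (a :: y), z, z'; split=> //.
    by rewrite /= pad_cons.
  case/acc_tailsP=> z [z' [Hz -> ->]]; exists [::], z, z'; split=> //=.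
  by case: z' {Hz} => [|b z'] /=; rewrite ?pad_cons ?pad_consl.
case=> y [z [z' [Hy Hz ->]]]; elim: y q Hy => [|a y IH] q /= Hy.
  have -> : pad (c :: z) z' = (Some c, ohead z') :: pad z (behead z').
    by case: z' {Hz} => [|b z'] /=; rewrite ?pad_cons ?pad_consl.
  apply/existsP; exists (inr (false, ohead z')); rewrite /= !eqxx Hy /= orbT.
  by apply/acc_tailsP; exists z, z'.
rewrite pad_cons; apply/existsP; exists (inl (dtrans q a)).
by rewrite /= !eqxx /=; apply: IH.
Qed.

Lemma regular_shift : regular_rel shift_rel.
Proof.
exists (powerset_dfa (inl (dstart Y)) delta fin) => x; rewrite powersetP acc_shiftP.
split=> [[y [z [z' [Hy Hz ->]]]]|[u [v [[y [z [z' [Hy Hz -> ->]]]]] ->]]].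
  by exists (y ++ c :: z), (y ++ z'); split=> //; exists y, z, z'.
by exists y, z, z'.
Qed.
End Shift.
End Pads.

(** * The automatic structure *)

Section ShiftForms.
Variable G : finType.

Definition all_dfa : dfa G := @Dfa G unit tt xpredT (fun _ _ => tt).
Definition ends_dfa (g : G) : dfa G := @Dfa G bool false id (fun _ a => a == g).

Lemma accepts_ends g u : accepts (ends_dfa g) u <-> exists y, u = rcons y g.
Proof.
split; last by case=> y ->; rewrite /accepts -cats1 foldl_cat /= eqxx.
by case/lastP: u => // y a; rewrite /accepts -cats1 foldl_cat /= cats1 => /eqP ->; exists y.
Qed.

Definition fst_tail (l : option (G * G)) := if l is Some p then [:: p.1] else [::].
Definition snd_tail (l : option (G * G)) := if l is Some p then [:: p.2] else [::].

Lemma tailsP P l z z' : tails P l z z' <->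
  exists2 z0, all P z0 & z = z0 ++ fst_tail l /\ z' = z0 ++ snd_tail l.
Proof.
split.
  elim=> {z z'} [->|g g' ->|a z z' Pa _ [z0 Pz [-> ->]]]; try by exists [::].
  by exists (a :: z0); rewrite //= Pa.
case=> z0 Pz [-> ->]; elim: z0 Pz => [_|a z0 IH /= /andP[Pa /IH]]; last exact: tails_cons.
by case: l => [[g g']|]; [apply: tails_end | apply: tails_nil].
Qed.
End ShiftForms.

Section QueueAutomatic.
Variables (A S : finType) (act : S -> qinstr A S) (h : S).
Local Notation gen := (gen A S).
Local Notation nfs := (nfs A S).
Local Notation step := (step act h).
Local Notation nf := (nf act h).
Local Notation rho := (rho act h).
Local Notation cong := (cong_gen (qrels act h)).
Local Notation summary := (option (sep A S) * option A * bool)%type.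

(** The finite information on the top block that decides irreducibility: under [Sh], only the first
    letter is compared with the first pop. *)
Definition summ (s : nfs) : summary :=
  match s with
  | Bot x w => (None, ohead x, w != [::])
  | Fr _ c x w => (Some c, ohead x, w != [::])
  end.

Definition reducible (q : summary) (c : sep A S) :=
  match c, q with
  | En, (Some Sh, None, false) => true
  | En, (Some (Dl p), None, false) => p == h
  | Tk t, (Some (Dl p), None, false) => tr act p t != None
  | _, _ => false
  end.

Lemma redE s c : isSome (red act h s c) = reducible (summ s) c.
Proof.
case: c => [||p|t]; case: s => [x w|s [||q|t'] [|a x] [|b w]] //=; first by case: ifP.
by case: tr => [[op q']|].
Qed.

Definition lang_step (q : option summary) (g : gen) : option summary :=
  match q, g with
  | Some (c, hx, hw), Lt a => if hw then None else Some (c, Some (odflt a hx), false)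
  | Some (c, hx, hw), Pp a =>
      if [&& c == Some Sh, hx == Some a & ~~ hw] then None else Some (c, hx, true)
  | Some q, Sp c => if reducible q c then None else Some (Some c, None, false)
  | None, _ => None
  end.

Definition lang_dfa : dfa gen :=
  @Dfa gen (option summary) (Some (None, None, false)) (fun q => q != None) lang_step.

(** The type [nfs] also contains reducible stacks; [ok] selects the irreducible ones. *)
Fixpoint ok (s : nfs) :=
  match s with
  | Bot _ _ => true
  | Fr b c x w => [&& ok b, ~~ reducible (summ b) c & (c == Sh) ==> (strip x w == (x, w))]
  end.

Lemma norm_strip (c : sep A S) (p : seq A * seq A) (q := norm c p : seq A * seq A) :
  (c == Sh) ==> (strip q.1 q.2 == (q.1, q.2)).
Proof.
apply/implyP => /eqP E; rewrite /q E /=.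
have := strip_cat p.1 p.2 [::] [::]; rewrite !cats0 => <-.
by rewrite -surjective_pairing.
Qed.

Lemma ok_addop op s : ok s -> ok (addop op s).
Proof.
by case: s => //= b c x w /and3P[-> -> _]; have := norm_strip c (ext op (x, w)) => /= ->.
Qed.

Lemma ok_step s g : ok s -> ok (step s g).
Proof.
move=> Hs; case: g => [a|a|c] /=; try exact: ok_addop.
case E: red => [s'|] /=; last first.
  by rewrite Hs implybT andbT -redE E.
case: c E Hs => [||q|t] //; case: s => // b [||q|t'] //= [|? ?] [|? ?] //.
- by move=> [<-] /andP[].
- by case: eqP => // _ [<-] /andP[].
- by case: tr => [[op q']|] // [<-] /andP[Hb _] /=; rewrite ok_addop.
Qed.

Lemma nf_rcons u g : nf (rcons u g) = step (nf u) g.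
Proof. by rewrite /nf -cats1 foldl_cat. Qed.

Lemma ok_nf u : ok (nf u).
Proof. by elim/last_ind: u => // u g; rewrite nf_rcons; apply: ok_step. Qed.

(** Stripping never lengthens a word; hence a stripped pair cannot have equal heads. *)
Lemma strip_ncons a x w : strip x w <> (a :: x, a :: w) :> seq A * seq A.
Proof.
suff H : size (strip x w).1 <= size x by move=> E; rewrite E /= ltnn in H.
by elim: x w => [|b x IH] [|b' w] //=; case: ifP => // _; apply: leq_trans (IH _) _.
Qed.

Lemma lang_block c x w : (c == Some Sh) ==> (strip x w == (x, w)) ->
  foldl lang_step (Some (c, None, false)) (block x w) = Some (c, ohead x, w != [::]).
Proof.
move=> Hc; rewrite /block foldl_cat.
have -> : foldl lang_step (Some (c, None, false)) (map Lt x) = Some (c, ohead x, false).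
  by case: x {Hc} => //= a; elim.
case: w Hc => // b w Hc /=; rewrite andbT ifF; first by elim: w {Hc} => //= b' w; rewrite !andbF.
apply/negP => /andP[/eqP Ec]; case: x Hc => // a x; rewrite Ec eqxx /= => Hc /eqP[E].
by move: Hc; rewrite E eqxx => /eqP/strip_ncons.
Qed.

Lemma lang_word s : ok s -> foldl lang_step (Some (None, None, false)) (word s) = Some (summ s).
Proof.
elim: s => [x w _|b IH c x w] /=; first by rewrite lang_block.
case/and3P=> /IH Hb Hr Hc; rewrite foldl_cat Hb /=.
by case: (summ b) Hr => [[c' hx] hw] /negbTE ->; rewrite lang_block.
Qed.

(** While the acceptor survives, multiplication merely appends the generator, so accepted words are
    their own normal forms. *)
Lemma lang_step_nf s g q : ok s -> lang_step (Some (summ s)) g = Some q ->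
  word (step s g) = rcons (word s) g /\ summ (step s g) = q.
Proof.
case: g => [a|a|c] Hs.
- have Elt x : ohead (rcons x a) = Some (odflt a (ohead x)) by case: x.
  case: s Hs => [x [|b w]|b c x [|b' w]] //= Hs [<-]; rewrite /block ?cats0.
    by rewrite map_rcons Elt.
  have -> : norm c (ext (true, a) (x, [::])) = (rcons x a, [::]).
    by case: c {Hs} => //=; case: (rcons _ _).
  by rewrite /= cats0 map_rcons Elt rcons_cat.
- case: s Hs => [x w|b c x w] /= Hs.
    by move=> [<-]; rewrite /block map_rcons rcons_cat; case: w.
  case: ifP => // Hc [<-].
  have -> : norm c (ext (false, a) (x, w)) = (x, rcons w a).
    have : c == Sh -> strip x w = (x, w) by case/and3P: Hs => _ _ /implyP H /H /eqP.
    case: c {Hs} Hc => // Hc /(_ isT); move: Hc; rewrite /ext /=.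
    case: x w => [|a' x] [|b' w] //=.
      by rewrite andbT => /eqP; case: eqP => // ->.
    by move=> _; case: eqP => // -> /strip_ncons.
  by rewrite /= /block map_rcons !rcons_cat /= rcons_cat; case: w {Hs Hc}.
- have := redE s c; rewrite /=; case: (summ s) => [[c' hx] hw] <-.
  by case: red => //= -[<-]; rewrite cats1.
Qed.
Lemma lang_acceptsP u : accepts lang_dfa u <-> rho u = u.
Proof.
rewrite /accepts /=; split; last by move=> <-; rewrite lang_word ?ok_nf.
suff H : forall q, foldl lang_step (Some (None, None, false)) u = Some q ->
    rho u = u /\ summ (nf u) = q.
  by case E: foldl => [q|] // _; case: (H q E).
elim/last_ind: u => [|u g IH] q; first by move=> [<-].
rewrite -cats1 foldl_cat cats1 /=; case E: foldl => [q'|] //.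
have [Eu Eq] := IH _ E; rewrite -{}Eq => /(lang_step_nf (ok_nf u)) [E1 E2].
by rewrite /rho nf_rcons E1 E2 -{2}Eu.
Qed.

(** * Right multiplication by a generator as a regular relation *)

Definition isLt (g : gen) := if g is Lt _ then true else false.
Definition isPp (g : gen) := if g is Pp _ then true else false.

Local Notation tail := (option (gen * gen)).
Definition flip (l : tail) : tail := omap (fun p => (p.2, p.1)) l.
Definition invop (op : bool * A) := (~~ op.1, op.2).

(** Insertion is deletion read backwards, so the pair of last letters is flipped too. *)
Definition ins_rel (g : gen) (P : pred gen) (l : tail) u v :=
  shift_rel (all_dfa gen) g P (flip l) v u.

(** Either the new letter is inserted (a push before the pops, a pop at the very end), or it cancels
    its partner standing right after [Sh]. A change of last letter [l] serves the tokens, which turn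
    [Dl p] into [Dl p']. *)
Definition block_rel (op : bool * A) (l : tail) u v :=
  ins_rel (opgen op) (fun z => op.1 && isPp z) l u v \/
  shift_rel (ends_dfa (Sp Sh : gen)) (opgen (invop op)) (if op.1 then isPp else isLt) l u v.

(** Deliberately generous: it relates only words congruent after multiplication and contains every
    normal form paired with its product. Restriction to normal forms then makes it exact. *)
Definition mul_rel (g : gen) : seq gen -> seq gen -> Prop :=
  match g with
  | Lt a => block_rel (true, a) None
  | Pp a => block_rel (false, a) None
  | Sp En => fun u v : seq gen => ins_rel g pred0 None u v \/
     (shift_rel (all_dfa gen) (Sp Sh) pred0 None u v \/
      shift_rel (all_dfa gen) (Sp (Dl h)) pred0 None u v)
  | Sp (Tk t) => fun u v : seq gen => ins_rel g pred0 None u v \/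
     exists p, if tr act p t is Some (op, p')
               then block_rel op (Some (Sp (Dl p), Sp (Dl p'))) u v else False
  | Sp _ => ins_rel g pred0 None
  end.

Lemma regular_ins g P l : regular_rel (ins_rel g P l).
Proof. exact/regular_swap/regular_shift. Qed.

Lemma regular_block op l : regular_rel (block_rel op l).
Proof. by apply: regular_or; [apply: regular_ins | apply: regular_shift]. Qed.

Lemma regular_mul g : regular_rel (mul_rel g).
Proof.
case: g => [a|a|[||p|t]] /=; try exact: regular_block; try exact: regular_ins.
  by do 2!(apply: regular_or; first by [exact: regular_ins | exact: regular_shift]); exact: regular_shift.
apply: regular_or; first exact: regular_ins.
apply: regular_bigor => p; case: (tr act p t) => [[op p']|]; first exact: regular_block.
exact: regular_false.
Qed.

Lemma insP g P l u v : ins_rel g P l u v <-> exists y z,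
  [/\ all P z, u = y ++ z ++ fst_tail l & v = y ++ g :: z ++ snd_tail l].
Proof.
split.
  case=> y [z [z' [_ /tailsP[z0 Pz [-> ->]] -> ->]]]; exists y, z0; split=> //.
    by case: l => [[]|].
  by case: l => [[]|].
case=> y [z [Pz -> ->]]; exists y, (z ++ snd_tail l), (z ++ fst_tail l); split=> //.
by apply/tailsP; exists z => //; case: l => [[]|].
Qed.

Lemma delP g P l u v : shift_rel (ends_dfa (Sp Sh : gen)) g P l u v <-> exists y z,
  [/\ all P z, u = y ++ Sp Sh :: g :: z ++ fst_tail l & v = y ++ Sp Sh :: z ++ snd_tail l].
Proof.
split.
  case=> y [z [z' [/accepts_ends[y0 ->] /tailsP[z0 Pz [-> ->]] -> ->]]].
  by exists y0, z0; rewrite !cat_rcons.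
case=> y [z [Pz -> ->]]; exists (rcons y (Sp Sh)), (z ++ fst_tail l), (z ++ snd_tail l).
split; rewrite ?cat_rcons //; first by apply/accepts_ends; exists y.
by apply/tailsP; exists z.
Qed.

Lemma rmP g u v : shift_rel (all_dfa gen) g pred0 None u v <-> u = rcons v g.
Proof.
split; last by move=> ->; exists v, [::], [::]; rewrite cats1 cats0; split=> //; apply: tails_nil.
case=> y [z [z' [_ /tailsP[[|? z0] // _ [-> ->]] -> ->]]].
by rewrite /= cats0 cats1.
Qed.

Lemma app_insP g u v : ins_rel g pred0 None u v <-> v = rcons u g.
Proof. exact: rmP. Qed.

Lemma all_isPp z : all isPp z -> exists w, z = map Pp w.
Proof.
elim: z => [|[a|a|c] z IH] //=; first by exists [::].
by case/IH=> w ->; exists (a :: w).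
Qed.

Lemma all_isLt z : all isLt z -> exists x, z = map Lt x.
Proof.
elim: z => [|[a|a|c] z IH] //=; first by exists [::].
by case/IH=> w ->; exists (a :: w).
Qed.

(** An inserted letter can pass between its place and the end of the block; for a deletion, the new
    letter passes to the left until it meets its partner at [Sh]. *)
Lemma block_rel_sound op l u v q : block_rel op l (u ++ fst_tail l) (v ++ snd_tail l) ->
  cong (u ++ opgen op :: q) (v ++ q).
Proof.
have tailI (y y' : seq gen) : y ++ fst_tail l = y' ++ fst_tail l -> y = y'.
  by case: l => [[g g']|] /=; rewrite ?cats0 // !cats1 => /rcons_inj[].
have tailI' (y y' : seq gen) : y ++ snd_tail l = y' ++ snd_tail l -> y = y'.
  by move=> {tailI}; case: l => [[g g']|] /=; rewrite ?cats0 // !cats1 => /rcons_inj[].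
case.
  case/insP=> y [z [Pz]]; rewrite catA => /tailI -> ; rewrite -cat_cons catA => /tailI' ->.
  case: op Pz => -[] a /= Pz; last by case: z Pz => // _; rewrite cats0 -catA; apply: cg_refl.
  have [w ->] := all_isPp Pz; rewrite -!catA; exact: cong_pass.
case/delP=> y [z [Pz]]; rewrite -2!cat_cons catA => /tailI ->.
rewrite -cat_cons catA => /tailI' ->.
case: op Pz => -[] a /= Pz.
  have [w ->] := all_isPp Pz; rewrite -!catA /=.
  have H := cong_pass act h w a (y ++ [:: Sp Sh; Pp a]) q; rewrite -!catA /= in H.
  apply: cg_trans H _; apply: cg_trans (cong_cancel act h a y (map Pp w ++ q)).
  apply: cg_sym; have := cong_swap act h a a (y ++ [:: Sp Sh]) (map Pp w ++ q).
  by rewrite -!catA.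
have [x ->] := all_isLt Pz; rewrite -!catA /=.
have H := cong_pass_left act h a x (y ++ [:: Sp Sh; Lt a]) q; rewrite -!catA /= in H.
by apply: cg_trans H _; apply: cong_cancel.
Qed.

Lemma mul_rel_sound g u v : mul_rel g u v -> cong (rcons u g) v.
Proof.
have Happ g' u' v' : ins_rel g' pred0 None u' v' -> cong (rcons u' g') v'.
  by move/app_insP ->; apply: cg_refl.
have Hblock op : block_rel op None u v -> cong (rcons u (opgen op)) v.
  have := @block_rel_sound op None u v [::]; rewrite /= !cats0 cats1.
  exact.
case: g => [a|a|[||p|t]]; try exact: Happ.
- exact: (Hblock (true, a)).
- exact: (Hblock (false, a)).
- case=> [|[/rmP ->|/rmP ->]]; first exact: Happ.
    by have := cong_end act h v [::]; rewrite cats0 -!cats1 -catA.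
  by have := cong_halt act h v [::]; rewrite cats0 -!cats1 -catA.
case=> [|[p]]; first exact: Happ.
case E: (tr act p t) => [[op p']|] // H.
have [u0 [v0 [Eu Ev]]] : exists u0 v0, u = u0 ++ [:: Sp (Dl p)] /\ v = v0 ++ [:: Sp (Dl p')].
  case: H => [/insP|/delP] [y [z [_ -> ->]]] /=.
    by exists (y ++ z), (y ++ opgen op :: z); rewrite -!catA.
  exists (y ++ Sp Sh :: opgen (invop op) :: z), (y ++ Sp Sh :: z); by rewrite -!catA.
rewrite Eu Ev in H *; rewrite -cats1 -catA.
have H1 := cong_rule h u0 [::] E; apply: cg_trans H1 _.
exact: (@block_rel_sound op (Some (Sp (Dl p), Sp (Dl p'))) u0 v0 [:: Sp (Dl p')] H).
Qed.

(** In a stripped block under [Sh], a new letter cancels only if its own side is empty and the other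
    side starts with it; otherwise it is inserted. *)
Lemma block_rel_addop op l s : ok s ->
  block_rel op l (word s ++ fst_tail l) (word (addop op s) ++ snd_tail l).
Proof.
have Hins y x w : block_rel op l ((y ++ block x w) ++ fst_tail l)
    ((y ++ block (ext op (x, w)).1 (ext op (x, w)).2) ++ snd_tail l).
  left; apply/insP; case: op => -[] a; rewrite /ext /block /=.
    exists (y ++ map Lt x), (map Pp w); split; first by elim: w.
      by rewrite -!catA.
    by rewrite map_rcons cat_rcons -!catA.
  exists (y ++ map Lt x ++ map Pp w), [::]; split=> //.
  by rewrite map_rcons -cats1 -!catA.
case: s => [x w|b c x w] Hok; first exact: (Hins [::]).
case: (c =P Sh) => [Ec|Ec]; last first.
  have -> : addop op (Fr b c x w) = Fr b c (ext op (x, w)).1 (ext op (x, w)).2.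
    by case: c Ec {Hok}.
  by have := Hins (rcons (word b) (Sp c)) x w; rewrite !cat_rcons.
have : strip x w = (x, w) by case/and3P: Hok => _ _ /implyP H; apply/eqP/H/eqP.
move: Hok => _; rewrite {}Ec => Hs.
have [E|E] : norm (Sh : sep A S) (ext op (x, w)) = ext op (x, w) \/
    (op.1 /\ x = [::] /\ exists w', w = op.2 :: w') \/
    (~~ op.1 /\ w = [::] /\ exists x', x = op.2 :: x').
  case: op {Hins} => -[] a; rewrite /ext /=.
    case: x Hs => [|b' x] Hs; last first.
      case: w Hs => [|b'' w] /=; first by left.
      by case: eqP => [-> /strip_ncons|]; auto.
    case: w Hs => [|b' w] _ /=; first by left.
    case: eqP => [->|]; last by left.
    by right; left; do 2!split=> //; exists w.
  case: w Hs => [|b' w] Hs; last first.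
    case: x Hs => [|b'' x] /=; first by left.
    by case: eqP => [-> /strip_ncons|]; auto.
  case: x Hs => [|b' x] _ /=; first by left.
  case: eqP => [->|]; last by left.
  by right; right; do 2!split=> //; exists x.
- have := Hins (rcons (word b) (Sp Sh)) x w; rewrite !cat_rcons => H.
  have -> // : word (addop op (Fr b Sh x w)) =
     word b ++ Sp Sh :: block (ext op (x, w)).1 (ext op (x, w)).2.
  by rewrite /= -[strip _ _]/(norm (Sh : sep A S) (ext op (x, w))) E.
- right; apply/delP; case: op E {Hins} => d a /= [[Hd [-> [w' ->]]]|[Hd [-> [x' ->]]]].
    exists (word b), (map Pp w'); rewrite Hd /= eqxx -!catA; split=> //; by elim: w'.
  exists (word b), (map Lt x'); rewrite (negbTE Hd) /= eqxx -!catA; split=> //.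
  - by elim: x'.
  - by rewrite /block cats0.
  - by case: x' => [|? ?]; rewrite /block /= ?cats0.
Qed.
Lemma mul_rel_complete s g : ok s -> mul_rel g (word s) (word (step s g)).
Proof.
move=> Hs; have none op : block_rel op None (word s) (word (addop op s)).
  by have := block_rel_addop op None Hs; rewrite !cats0.
have app c : red act h s c = None -> ins_rel (Sp c) pred0 None (word s) (word (step s (Sp c))).
  by move=> E; apply/app_insP; rewrite /= E /= cats1.
case: g => [a|a|c]; [exact: none | exact: none | case E: (red act h s c) => [s'|]]; last first.
  by case: c E => [||p|t] E; do ?left; apply: app.
case: c E => [||q|t] //; case: s Hs {none app} => // b [||q|t'] //= [|? ?] [|? ?] //= Hok.
- by move=> _; right; left; apply/rmP; rewrite cats1.
- by case: eqP => // -> _; right; right; apply/rmP; rewrite cats1.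
- case E: (tr act q t) => [[op q']|] // _; right; exists q; rewrite E /=.
  by apply: (block_rel_addop op (Some (Sp (Dl q), Sp (Dl q')))); case/andP: Hok.
Qed.

Local Notation sigma := (nf_of (@cong_rho _ _ act h) (@rho_cong _ _ act h)).

(** Representatives are unique, so equality in the monoid is the diagonal. *)
Lemma regular_eq_nf : regular_rel (fun u v =>
  accepts lang_dfa u /\ accepts lang_dfa v /\ sigma u = sigma v).
Proof.
apply: regular_ext (regular_and lang_dfa lang_dfa (regular_diag _)) => u v.
split=> [[Hu Hv ->]|[Hu [Hv /nf_of_eq/rho_cong E]]] //; split=> //.
by rewrite -(proj1 (lang_acceptsP u) Hu) E; apply/lang_acceptsP.
Qed.

Lemma regular_mul_nf g : regular_rel (fun u v =>
  accepts lang_dfa u /\ accepts lang_dfa v /\ sigma (u ++ [:: g]) = sigma v).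
Proof.
apply: regular_ext (regular_and lang_dfa lang_dfa (regular_mul g)) => u v.
split=> [[Hu Hv H]|[Hu [Hv /nf_of_eq/rho_cong E]]].
  by split=> //; split=> //; apply/nf_of_eq; rewrite cats1; apply: mul_rel_sound.
split=> //; move/lang_acceptsP: Hv E => -> <-.
rewrite cats1 /rho nf_rcons; have := mul_rel_complete g (ok_nf u).
by rewrite -[word (nf u)]/(rho u) (proj1 (lang_acceptsP u) Hu).
Qed.
End QueueAutomatic.

(** * Right inverses and runs of the queue machine *)

Section RightInverse.
Variables (A S : finType) (act : S -> qinstr A S) (h : S).
Hypothesis act_h : act h = QStop.
Local Notation nfs := (nfs A S).
Local Notation step := (step act h).
Local Notation nf := (nf act h).
Local Notation red := (red act h).
Local Notation empty := (Bot [::] [::]).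
Local Notation sigma := (nf_of (@cong_rho _ _ act h) (@rho_cong _ _ act h)).

Definition erasable (s : nfs) := exists t, foldl step s t = empty.

Lemma word_nil (s : nfs) : word s = [::] -> s = empty.
Proof. by case: s => [[|a x] [|b w]|b c x w] //=; case: (word b). Qed.

Lemma right_inverseP u : @has_right_inverse (qmonoid act h) (sigma u) <-> erasable (nf u).
Proof.
split=> [[s]|[t Ht]].
  rewrite -(nf_of_val (@cong_rho _ _ act h) (@rho_cong _ _ act h) s) /= nf_mul_of => /nf_of_eq.
  move/rho_cong => E; exists (val s); rewrite /nf -foldl_cat.
  exact: word_nil E.
exists (sigma t); rewrite /= nf_mul_of; apply/nf_of_eq.
apply: cg_trans (cg_sym (cong_rho act h _)) _.
by rewrite /rho /nf foldl_cat [foldl _ _ t]Ht; apply: cg_refl.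
Qed.

(** Places [z] on top of [b] and the separator [c], to separate what happens above a marker from
    what lies below. *)
Fixpoint graft b c (z : nfs) : nfs :=
  match z with
  | Bot x w => Fr b c x w
  | Fr z c' x w => Fr (graft b c z) c' x w
  end.

Lemma graft_addop b q op z : addop op (graft b (Dl q) z) = graft b (Dl q) (addop op z).
Proof. by case: z. Qed.

Lemma step_graft b q z g :
  step (graft b (Dl q) z) g = graft b (Dl q) (step z g) \/
  z = empty /\ exists c s', g = Sp c /\ red (Fr b (Dl q) [::] [::]) c = Some s'.
Proof.
case: g => [a|a|c] /=; try (by left; rewrite graft_addop).
case: z => [x w|z c' x w].
  case: x w => [|a x] [|a' w]; try by left; case: c.
  case E: (red (Fr b (Dl q) [::] [::]) c) => [s'|]; first by right; split=> //; exists c, s'.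
  by left; case: c E => //=.
left; case: c => [||p|t] //=; case: c' => [||p'|t'] //=; case: x w => [|? ?] [|? ?] //=.
  by case: eqP.
by case: tr => [[op q']|] //=; rewrite graft_addop.
Qed.

(** Nothing below the marker changes until the part above it is gone and a generator reduces with
    the marker; what remains of [t] erases the result. *)
Lemma erasable_marker b q t z : foldl step (graft b (Dl q) z) t = empty ->
  exists c s', red (Fr b (Dl q) [::] [::]) c = Some s' /\ erasable s'.
Proof.
elim: t z => [|g t IH] z /=; first by case: z.
case: (step_graft b q z g) => [-> /IH|[-> [c [s' [-> E]]]]] //=.
by rewrite E /= => Ht; exists c, s'; split=> //; exists t.
Qed.

Lemma erasableP b q : erasable (Fr b (Dl q) [::] [::]) <->
  (exists a op q', tr act q a = Some (op, q') /\ erasable (Fr (addop op b) (Dl q') [::] [::])) \/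
  (q = h /\ erasable b).
Proof.
split=> [[t /(@erasable_marker b q t empty)]|[[a [op [q' [E [t Ht]]]]]|[-> [t Ht]]]].
- case=> -[||p|a] [s' []] //=.
    by case: eqP => // -> [<-]; right.
  by case E: tr => [[op q']|] // [<-] H; left; exists a, op, q'.
- by exists (Sp (Tk a) :: t); rewrite /= E.
- by exists (Sp En :: t); rewrite /= eqxx.
Qed.

Definition mismatch (p : seq A * seq A) :=
  if p is (a :: _, b :: _) then a != b else false.

Lemma strip_mismatch p : mismatch p -> strip p.1 p.2 = p.
Proof. by case: p => -[|a x] [|b w] //= /negbTE ->. Qed.

Lemma mismatch_ext op p : mismatch p -> mismatch (ext op p).
Proof. by case: p op => -[|a x] [|b w] // [[] c]. Qed.

(** A wrong guess leaves different letters facing each other at [Sh]. Later letters join behind them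
    and [En] needs an empty block, so the obstruction is permanent. *)
Fixpoint stuck (s : nfs) :=
  if s is Fr b c x w then (c == Sh) && mismatch (x, w) || stuck b else false.

Lemma stuck_addop op s : stuck s -> stuck (addop op s).
Proof.
case: s => // b c x w /= /orP[/andP[/eqP -> Hm]|->]; last by rewrite orbT.
have := @mismatch_ext op (x, w) Hm; case: (ext op (x, w)) => x' w' Hm'.
by have := strip_mismatch Hm' => /= ->; rewrite /= in Hm'; rewrite Hm'.
Qed.

Lemma stuck_step g s : stuck s -> stuck (step s g).
Proof.
move=> Hs; case: g => [a|a|c]; try exact: stuck_addop.
case: c => [||p|t] //=; case: s Hs => [x w|b [||p'|t'] [|? ?] [|? ?]] //=.
  by case: eqP.
by case: tr => [[op q']|] //= Hs; rewrite stuck_addop.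
Qed.

Lemma stuck_not_erasable s : stuck s -> ~ erasable s.
Proof.
move=> Hs [t]; elim: t s Hs => [|g t IH] s Hs /=; first by case: s Hs.
by apply: IH; apply: stuck_step.
Qed.

Definition config q u : nfs := Fr (Fr empty Sh u [::]) (Dl q) [::] [::].
Definition config_word q u : seq (gen A S) := Sp Sh :: map Lt u ++ [:: Sp (Dl q)].

Lemma strip0 (x : seq A) : strip x [::] = (x, [::]). Proof. by case: x. Qed.

Lemma nf_config_word q u : nf (config_word q u) = config q u.
Proof.
rewrite /nf /= foldl_cat /=; congr (Fr _ _ [::] [::]).
suff H v : foldl step (Fr empty Sh v [::]) (map Lt u) = Fr empty Sh (v ++ u) [::] by rewrite H.
by elim: u v => [|a u IH] v /=; rewrite ?cats0 // strip0 IH cat_rcons.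
Qed.

Lemma word_config q u : word (config q u) = config_word q u.
Proof. by rewrite /= /block cats0. Qed.

Definition qnext (p p' : S * seq A) :=
  match act p.1, p.2 with
  | QPush a s, u => p' = (s, rcons u a)
  | QPop k, a :: u => p' = (k a, u)
  | _, _ => False
  end.

Inductive qrun : S * seq A -> S * seq A -> Prop :=
| qrun_refl p : qrun p p
| qrun_step p1 p2 p3 : qnext p1 p2 -> qrun p2 p3 -> qrun p1 p3.

Lemma qrun_trans p1 p2 p3 : qrun p1 p2 -> qrun p2 p3 -> qrun p1 p3.
Proof. by elim=> // a b c Hab _ IH /IH; apply: qrun_step. Qed.

(** All tokens act alike on a push; on a pop a wrong token gives a stuck stack. As [h] stops, [En]
    cannot erase the state instead. Both directions hold, so a rejecting run refutes erasability. *)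
Lemma erasable_qnext p p' : qnext p p' ->
  erasable (config p.1 p.2) <-> erasable (config p'.1 p'.2).
Proof.
case: p => q u; rewrite /qnext /=; case Ea: (act q) => [a s|k|] //.
  move=> -> /=; rewrite /config erasableP /tr Ea; split.
    case=> [[_ [op [q' [[<- <-]]]]]|[Eq _]]; first by rewrite /= strip0.
    by have := act_h; rewrite -Eq Ea.
  by move=> H; left; exists a, (true, a), s; split=> //=; rewrite strip0.
case: u => // a u -> /=; rewrite /config erasableP /tr Ea; split.
  case=> [[a' [op [q' [[<- <-]]]]]|[Eq _]]; last by have := act_h; rewrite -Eq Ea.
  rewrite /= /ext /=; case: (a =P a') => [->|/eqP ne]; first by rewrite strip0.
  by move/stuck_not_erasable => -[]; rewrite /= (negbTE ne) /= ?ne.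
by move=> H; left; exists a, (false, a), (k a); split=> //=; rewrite /= eqxx strip0.
Qed.

Lemma erasable_qrun p p' : qrun p p' ->
  erasable (config p.1 p.2) <-> erasable (config p'.1 p'.2).
Proof. by elim=> // p1 p2 p3 /erasable_qnext -> _. Qed.

Lemma erasable_halt : erasable (config h [::]).
Proof. by exists [:: Sp En; Sp En]; rewrite /= eqxx. Qed.

Lemma not_erasable_stop q u : act q = QStop -> q != h -> ~ erasable (config q u).
Proof.
move=> Eq qh; rewrite /config erasableP /tr Eq => -[[a [op [q' []]]]|[E _]] //.
by rewrite E eqxx in qh.
Qed.
End RightInverse.

(** * A queue machine iterating an arithmetic map *)

Section CollatzQueue.
Variables (Q T : nat).
Hypothesis Q_gt1 : 1 < Q.
Let m := Q ^ 2.
Let a r := digit (Q ^ 4) T (2 * r).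
Let b r := digit (Q ^ 4) T (2 * r + 1).
(** A common bound for the residues mod [Q ^ 2] and the coefficients below [Q ^ 4], which keeps the
    state set finite. *)
Let N := Q ^ 4 + Q ^ 2.

Definition cstate : finType := ('I_9 * ('I_N.+1 * 'I_N.+1))%type.
Definition st k i j : cstate := (inord k, (inord i, inord j)).
Definition st_write r q := if q == 0 then st 3 r 0 else st 4 r q.

(* The queue holds [n] ones ([true]) and an end marker ([false]).  Stages 0-2 rotate it
   once to compute [r = n mod m]; stages 3-5 rotate it again, replacing every [m] ones by
   [a r] ones and the remaining [r] ones by [b r] ones; stage 6 empties the queue before
   the halting stage 7; stage 8 rejects. *)
Definition caction (k i j : nat) : qinstr bool cstate :=
  match k with
  | 0 => QPop (fun one : bool => if one then st 1 i 0 else st 2 i 0)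
  | 1 => QPush true (st 0 (i.+1 %% m) 0)
  | 2 => QPush false (if i %% Q == 0 then st 6 0 0 else if i %% Q == 1 then st 8 0 0 else st 3 i 0)
  | 3 => QPop (fun one : bool => if one then
           (if j.+1 < m then st 3 i j.+1 else st_write i (a i)) else st 5 (b i) 0)
  | 4 => QPush true (st_write i j.-1)
  | 5 => if i == 0 then QPush false (st 0 0 0) else QPush true (st 5 i.-1 0)
  | 6 => QPop (fun one : bool => if one then st 6 0 0 else st 7 0 0)
  | _ => QStop
  end.

Definition cact (s : cstate) := caction s.1 s.2.1 s.2.2.

Lemma cact_st k i j : k < 9 -> i <= N -> j <= N -> cact (st k i j) = caction k i j.
Proof. by move=> Hk Hi Hj; rewrite /cact /= !inordK. Qed.

Lemma m_gt0 : 0 < m. Proof. by rewrite expn_gt0; lia. Qed.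
Lemma m_leN : m <= N. Proof. by rewrite leq_addl. Qed.
Lemma digit_leN i : digit (Q ^ 4) T i <= N.
Proof.
have Q4 : 0 < Q ^ 4 by rewrite expn_gt0; lia.
by have := ltn_pmod (T %/ (Q ^ 4) ^ i) Q4; rewrite /digit /N; lia.
Qed.

Local Notation qrun := (qrun cact).

Lemma qrun1 p p' : qnext cact p p' -> qrun p p'.
Proof. by move=> H; apply: qrun_step H (qrun_refl _ _). Qed.

Lemma count_run n c u : c < m ->
  qrun (st 0 c 0, nseq n true ++ u) (st 0 ((c + n) %% m) 0, u ++ nseq n true).
Proof.
have mN := m_leN; elim: n c u => [|n IH] c u Hc.
  by rewrite addn0 modn_small // cats0; apply: qrun_refl.
apply: (@qrun_step _ _ _ _ (st 1 c 0, nseq n true ++ u)).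
  by rewrite /qnext /= cact_st //; lia.
apply: (@qrun_step _ _ _ _ (st 0 (c.+1 %% m) 0, nseq n true ++ rcons u true)).
  by rewrite /qnext /= cact_st /= ?rcons_cat //; lia.
have := IH (c.+1 %% m) (rcons u true) (ltn_pmod _ m_gt0).
by rewrite modnDml addSnnS cat_rcons.
Qed.

Lemma write_run r q u : r < m -> q <= N ->
  qrun (st_write r q, u) (st 3 r 0, u ++ nseq q true).
Proof.
have mN := m_leN; elim: q u => [|q IH] u Hr Hq.
  by rewrite cats0; apply: qrun_refl.
apply: (@qrun_step _ _ _ _ (st_write r q, rcons u true)).
  by rewrite /qnext /= cact_st //; lia.
by have := IH (rcons u true) Hr (ltnW Hq); rewrite cat_rcons.
Qed.

Lemma read_run r j n u : r < m -> j + n < m ->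
  qrun (st 3 r j, nseq n true ++ u) (st 3 r (j + n), u).
Proof.
have mN := m_leN; elim: n j => [|n IH] j Hr Hj; first by rewrite addn0; apply: qrun_refl.
rewrite -addSnnS in Hj *; apply: qrun_step (IH _ Hr Hj).
by rewrite /qnext /= cact_st /= ?ifT //; lia.
Qed.

Lemma block_run r u : r < m ->
  qrun (st 3 r 0, nseq m true ++ u) (st 3 r 0, u ++ nseq (a r) true).
Proof.
move=> Hr; have mN := m_leN; have m0 := m_gt0.
have -> : nseq m true ++ u = nseq m.-1 true ++ (true :: u).
  by rewrite -{1}(prednK m0) -addn1 nseqD -catA.
apply: qrun_trans (@read_run r 0 m.-1 _ Hr _) _; first by lia.
apply: (@qrun_step _ _ _ _ (st_write r (a r), u)).
  by rewrite /qnext /= cact_st /= ?ifF //; lia.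
exact: write_run (digit_leN _).
Qed.

Lemma blocks_run r k u : r < m ->
  qrun (st 3 r 0, nseq (k * m) true ++ u) (st 3 r 0, u ++ nseq (a r * k) true).
Proof.
move=> Hr; elim: k u => [|k IH] u; first by rewrite muln0 cats0; apply: qrun_refl.
rewrite mulSn nseqD -catA mulnS nseqD [u ++ _]catA.
apply: qrun_trans (block_run _ Hr) _; rewrite -catA; exact: IH.
Qed.

Lemma flush_run q u : q <= N ->
  qrun (st 5 q 0, u) (st 0 0 0, u ++ nseq q true ++ [:: false]).
Proof.
elim: q u => [|q IH] u Hq.
  by apply: qrun1; rewrite /qnext /= cact_st //= cats1.
apply: (@qrun_step _ _ _ _ (st 5 q 0, rcons u true)).
  by rewrite /qnext /= cact_st.
by have := IH (rcons u true) (ltnW Hq); rewrite cat_rcons.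
Qed.

Lemma count_pass n : qrun (st 0 0 0, nseq n true ++ [:: false]) (st 2 (n %% m) 0, nseq n true).
Proof.
apply: qrun_trans (count_run _ _ m_gt0) _; apply: qrun1.
by rewrite /qnext /= cact_st ?add0n //; have := ltn_pmod n m_gt0; have := m_leN; lia.
Qed.

Lemma mod_mQ n : n %% m %% Q = n %% Q.
Proof. by rewrite modn_dvdm // dvdn_exp. Qed.

Lemma cstep_run n : 1 < n %% Q ->
  qrun (st 0 0 0, nseq n true ++ [:: false]) (st 0 0 0, nseq (cstep Q T n) true ++ [:: false]).
Proof.
move=> Hn; have Hr := ltn_pmod n m_gt0; have mN := m_leN.
apply: qrun_trans (count_pass n) _.
apply: (@qrun_step _ _ _ _ (st 3 (n %% m) 0, nseq n true ++ [:: false])).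
  rewrite /qnext /= cact_st //=; last by lia.
  by rewrite mod_mQ !ifF ?cats1 //; lia.
(* The full blocks of [m] ones are replaced, the fewer than [m] ones left over are swallowed
   silently, and the end marker then triggers the constant term. *)
rewrite {2}(divn_eq n m) nseqD -catA.
apply: qrun_trans (blocks_run _ _ Hr) _; rewrite -catA.
apply: qrun_trans (@read_run _ 0 _ _ Hr Hr) _; rewrite add0n.
apply: (@qrun_step _ _ _ _ (st 5 (b (n %% m)) 0, nseq (a (n %% m) * (n %/ m)) true)).
  by rewrite /qnext /= cact_st //; lia.
have := flush_run (nseq (a (n %% m) * (n %/ m)) true) (digit_leN (2 * (n %% m) + 1)).
by rewrite catA -nseqD.
Qed.

Lemma reach_run n n' : reach Q T n n' ->
  qrun (st 0 0 0, nseq n true ++ [:: false]) (st 0 0 0, nseq n' true ++ [:: false]).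
Proof.
elim=> [k|k k' Hk _ IH]; first exact: qrun_refl.
exact: qrun_trans (cstep_run Hk) IH.
Qed.

Lemma cact_halt : cact (st 7 0 0) = QStop.
Proof. by rewrite cact_st. Qed.

Lemma accept_run n : n %% Q = 0 ->
  qrun (st 0 0 0, nseq n true ++ [:: false]) (st 7 0 0, [::]).
Proof.
move=> Hn; have Hr := ltn_pmod n m_gt0; have mN := m_leN.
apply: qrun_trans (count_pass n) _.
apply: (@qrun_step _ _ _ _ (st 6 0 0, nseq n true ++ [:: false])).
  by rewrite /qnext /= cact_st //= ?mod_mQ ?Hn ?cats1 //; lia.
elim: n {Hn Hr} => [|n IH].
  by apply: qrun1; rewrite /qnext /= cact_st.
by apply: qrun_step IH; rewrite /qnext /= cact_st.
Qed.

Lemma reject_run n : n %% Q = 1 ->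
  qrun (st 0 0 0, nseq n true ++ [:: false]) (st 8 0 0, nseq n true ++ [:: false]).
Proof.
move=> Hn; have Hr := ltn_pmod n m_gt0; have mN := m_leN.
apply: qrun_trans (count_pass n) _; apply: qrun1.
by rewrite /qnext /= cact_st //= ?mod_mQ ?Hn ?cats1 //; lia.
Qed.

(** Erasability is invariant along runs: acceptance leads to the empty halting configuration,
    rejection to a stopping state other than the halting one. *)
Lemma erasable_reach n n' : reach Q T n n' -> n' %% Q <= 1 ->
  erasable cact (st 7 0 0) (config (st 0 0 0) (nseq n true ++ [:: false])) <-> n' %% Q = 0.
Proof.
move=> /reach_run Hrun Hle; have := erasable_qrun cact_halt Hrun => /= ->.
case: (posnP (n' %% Q)) => Hn'; split=> //; last by move=> E0; rewrite E0 in Hn'.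
  by move=> _; apply/(erasable_qrun cact_halt (accept_run Hn')); apply: erasable_halt.
have E1 : n' %% Q = 1 by lia.
move/(erasable_qrun cact_halt (reject_run E1)) => /= H; exfalso; move: H.
apply: not_erasable_stop; first by rewrite cact_st.
by apply/eqP => /(congr1 (fun s : cstate => val s.1)); rewrite /= !inordK.
Qed.
End CollatzQueue.

(** * Undecidability *)

Definition dfa_comap (B C : Type) (f : B -> C) (M : dfa C) : dfa B :=
  @Dfa B (dstate M) (dstart M) (@dfinal _ M) (fun q b => dtrans q (f b)).

Lemma accepts_comap (B C : Type) (f : B -> C) M w :
  accepts (dfa_comap f M) w = accepts M (map f w).
Proof. by rewrite /accepts /=; congr dfinal; elim: w (dstart M) => //=. Qed.

Lemma pad_map (X Y : finType) (f : X -> Y) (u v : seq X) :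
  pad (map f u) (map f v) = [seq (omap f p.1, omap f p.2) | p <- pad u v].
Proof.
have El w : pad (map f w) [::] = [seq (omap f p.1, omap f p.2) | p <- pad w [::]].
  by elim: w => // b w IH; rewrite map_cons !pad_consl IH.
have Er w : pad [::] (map f w) = [seq (omap f p.1, omap f p.2) | p <- pad [::] w].
  by elim: w => // b w IH; rewrite map_cons !pad_consr IH.
by elim: u v => [|a u IH] [|b v]; rewrite -?El -?Er // !map_cons !pad_cons IH.
Qed.

Lemma regular_comap (X Y : finType) (f : X -> Y) (g : Y -> X) R :
  cancel f g -> cancel g f -> regular_rel R ->
  regular_rel (fun u v => R (map f u) (map f v)).
Proof.
move=> fK gK [M HM].
exists (dfa_comap (fun p => (omap f p.1, omap f p.2)) M) => x; rewrite accepts_comap.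
split=> [/HM [u [v [H E]]]|[u [v [H ->]]]]; last first.
  by apply/HM; exists (map f u), (map f v); rewrite pad_map.
exists (map g u), (map g v); rewrite !(mapK gK); split=> //.
rewrite pad_map -E -map_comp -[LHS]map_id; apply: eq_map => -[p q] /=.
by case: p q => [?|] [?|] /=; rewrite ?fK.
Qed.

(** * Renaming the generators as ordinals *)

Section Transport.
Variables (A S : finType) (act : S -> qinstr A S) (h : S).
Local Notation X := (gen A S).
Local Notation sigma := (nf_of (@cong_rho _ _ act h) (@rho_cong _ _ act h)).
Let g : 'I_#|{: X}| -> X := enum_val.
Let f : X -> 'I_#|{: X}| := enum_rank.

Definition qsigma (u : seq 'I_#|{: X}|) : qmonoid act h := sigma (map g u).
Definition qlang : dfa 'I_#|{: X}| := dfa_comap g (lang_dfa act h).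

Lemma automatic_qmonoid : exists Meq Ma, automatic_structure qsigma qlang Meq Ma.
Proof.
have fK : cancel f g by apply: enum_rankK.
have gK : cancel g f by apply: enum_valK.
have [nil_m cat_m] := nf_of_morphism (@cong_rho _ _ act h) (@rho_cong _ _ act h).
have [Meq Heq] := regular_comap gK fK (regular_eq_nf act h).
have Hmul a := regular_comap gK fK (regular_mul_nf act h (g a)).
exists Meq, (fun a => sval (Hmul a)); split; last split; last split.
- by split=> // u v; rewrite /qsigma map_cat cat_m.
- move=> s; exists (map f (val s)); rewrite accepts_comap /qsigma mapK // nf_of_val.
  by split=> //; apply/lang_acceptsP/eqP; apply: (valP s).
- move=> x; rewrite Heq; split=> -[u [v [H ->]]]; exists u, v; split=> //.
    by rewrite !accepts_comap.
  by move: H; rewrite !accepts_comap.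
- move=> a x; rewrite (svalP (Hmul a)); split=> -[u [v [H ->]]]; exists u, v; split=> //.
    by move: H; rewrite !accepts_comap /qsigma map_cat.
  by move: H; rewrite !accepts_comap /qsigma map_cat.
Qed.
End Transport.

(** Prepending a letter is an affine map on codes, so a power of a letter is an iteration of one
    such map. *)
Lemma computable_word_code k (pre suf : seq 'I_k) (c : 'I_k) n F : computable n F ->
  computable n (fun xs => word_code (pre ++ nseq (F xs) c ++ suf)).
Proof.
have lin d n' E : computable n' E -> computable n' (fun xs => d + k * E xs).
  by move=> HE; exact: (computable_add (computable_const n' d)
                          (computable_mul (computable_const n' k) HE)).
move=> HF; elim: pre => [|a pre IH] /=; last exact: lin.
apply: (@computable_comp1 n (fun xs => word_code (nseq (nth 0 xs 0) c ++ suf)) _ _ HF).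
have := computable_rec (computable_const 0 (word_code suf))
  (lin c.+1 _ _ (computable_proj (n := 2) (i := 1) isT)).
by move/computable_ext; apply; comp_ext; elim: x0 => //= x0 ->.
Qed.

Theorem theorem5p1 :
  exists (S : monoid) (k : nat) (sigma : seq 'I_k -> S) (ML : dfa 'I_k)
         (Meq : dfa (option 'I_k * option 'I_k))
         (Ma : 'I_k -> dfa (option 'I_k * option 'I_k)),
    finitely_presented S /\
    automatic_structure sigma ML Meq Ma /\
    ~ decidable_on (fun w => accepts ML w) (fun w => has_right_inverse (sigma w)).
Proof.
(* The fixed map [(QU, TU)] simulates the universal function; its queue machine defines the
   monoid. *)
have [U HU] := universal_prf; have [QU [TU [QU1 Hrun]]] := reach_of_prf U.
pose act := @cact QU TU; pose h := st QU 7 0 0; pose start := st QU 0 0 0.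
have [Meq [Ma Haut]] := automatic_qmonoid act h.
exists (qmonoid act h), _, (qsigma act h), (qlang act h), Meq, Ma.
split; first exact: finitely_presented_nf.
split=> // -[F HF].
pose input n := config_word start (nseq n true ++ [:: false]).
pose w n := map enum_rank (input n).
have Hw n : map enum_val (w n) = input n by rewrite mapK //; apply: enum_rankK.
have Hcode : computable 2 (fun xs => word_code (w (cinit QU (nth 0 xs 0) (nth 0 xs 1)))).
  have := computable_word_code [:: enum_rank (Sp Sh : gen bool (cstate QU))]
    [:: enum_rank (Lt false : gen bool (cstate QU)); enum_rank (Sp (Dl start))]
    (enum_rank (Lt true : gen bool (cstate QU)))
    (computable_cinit (computable_const 2 QU) (computable_proj (n := 2) (i := 0) isT)
       (computable_proj (n := 2) (i := 1) isT)).
  move/computable_ext; apply=> xs _; congr word_code.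
  by rewrite /w /input /config_word /= !map_cat !map_nseq -catA.
have [G HG] := Hcode.
(* The diagonal: [(Q, T)] codes the map that applies the supposed decision procedure to the word on
   which the fixed machine simulates a given pair. It is now run on [(Q, T)] itself. *)
have [Q [T [Q1 Hself]]] := reach_of_prf (PComp F [:: G]).
pose n := cinit QU Q T.
have HL : accepts (qlang act h) (w n).
  rewrite accepts_comap Hw; apply/lang_acceptsP.
  by rewrite /rho nf_config_word word_config.
have Hri : has_right_inverse (qsigma act h (w n)) <->
    erasable act h (config start (nseq n true ++ [:: false])).
  by rewrite /qsigma Hw right_inverseP nf_config_word.
(* An answer [out] is the halting residue of [(Q, T)] on its own code, hence the value of [U], hence
   the halting residue of the fixed machine; residue 0 means right invertible. *)
have Hdec out : eval F [:: word_code (w n)] out -> out <= 1 ->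
    (has_right_inverse (qsigma act h (w n)) <-> out = 0).
  move=> Hout out1.
  have Heval : eval (PComp F [:: G]) [:: Q; T] out.
    apply: (ev_comp (ys := [:: word_code (w n)])) => //.
    by constructor; [exact: (HG [:: Q; T]) | constructor].
  have [n1 [R1 E1]] := Hself _ _ _ Heval.
  have Eb : (out != 0 : nat) = out by case: out out1 {Hout Heval E1} => [|[]].
  have := HU Q T n1 R1; rewrite E1 Eb => /(_ out1) /Hrun [n2 [R2 E2]].
  rewrite Hri (erasable_reach QU1 R2) E2 ?Eb //.
(* The procedure answers 1 for right invertible words, while invertibility was just tied to the
   answer 0. *)
have [[Hr Hout]|[Hr Hout]] := HF _ HL.
  by have := proj1 (Hdec _ Hout isT) Hr.
by apply: Hr; apply/(Hdec _ Hout isT).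
Qed.
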